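(* Let $k\geq 1$ and $\tau\in\mathbb{C}$. The Poisson algebra $\mathbb{C}[N_{k,\tau}]$ is generated, as a Poisson algebra, by its two commutative Poisson subalgebras $\mathbb{C}[\mathcal{R}(Q,V)]^{GL(k,\mathbb{C})}$ and $\mathbb{C}[\mathcal{R}(Q^{\rm op},V)]^{GL(k,\mathbb{C})}$. In other words, the smallest subalgebra of $\mathbb{C}[N_{k,\tau}]$ which is closed under the Poisson bracket and contains all functions induced by $GL(k,\mathbb{C})$-invariant polynomials in $(A,i_1,j_2)$ and all functions induced by $GL(k,\mathbb{C})$-invariant polynomials in $(B,i_2,j_1)$ is $\mathbb{C}[N_{k,\tau}]$ itself.
   Context: $M_{p,q}$ is the space of complex $p\times q$ matrices. $N_{k,\tau}=\{(A,B,i,j)\in M_{k,k}\times M_{k,k}\times M_{k,2}\times M_{2,k}:\ [A,B]-ij=\tau\cdot 1\}/GL(k,\mathbb{C})$, where $g\in GL(k,\mathbb{C})$ acts by $(A,B,i,j)\mapsto(gAg^{-1},gBg^{-1},gi,jg^{-1})$. Put $\mu(A,B,i,j)=[A,B]-ij$, so that $N_{k,\tau}=\mu^{-1}(\tau\cdot 1)/GL(k,\mathbb{C})$. For $\tau\neq 0$ all orbits in $\mu^{-1}(\tau\cdot 1)$ are closed and $N_{k,\tau}$ is a manifold; for $\tau=0$ the quotient is understood as the affine quotient $N_{k,0}=\operatorname{Spec}\mathbb{C}[\mu^{-1}(0)]^{GL(k,\mathbb{C})}$, whose points are the closed orbits. In all cases $\mathbb{C}[N_{k,\tau}]=\mathbb{C}[\mu^{-1}(\tau\cdot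 1)]^{GL(k,\mathbb{C})}$. $N_{k,\tau}$ is the complex-symplectic quotient of the space of all $(A,B,i,j)$ with symplectic form $\operatorname{tr}dA\wedge dB+\operatorname{tr}dj\wedge di$, and the Poisson bracket on $\mathbb{C}[N_{k,\tau}]$ is the induced one. Write $i=(i_1,i_2)$ (columns) and $j=\begin{pmatrix}j_1\\ j_2\end{pmatrix}$ (rows). $Q$ is the quiver with vertices $1,2$, a loop $a$ at $1$, an arrow $x$ from $2$ to $1$ and an arrow $y$ from $1$ to $2$; $Q^{\rm op}$ is obtained by reversing all arrows; $V=(\mathbb{C}^k,\mathbb{C})$. The representation space $\mathcal{R}(Q,V)\simeq M_{k,k}\times M_{k,1}\times M_{1,k}$ corresponds to the components $(A,i_1,j_2)$ of $(A,B,i,j)$ (up to signs), and $\mathcal{R}(Q^{\rm op},V)\simeq M_{k,k}\times M_{k,1}\times M_{1,k}$ to the components $(B,i_2,j_1)$. The invariant polynomial functions on each are regarded as functions on $N_{k,\tau}$ by restriction to $\mu^{-1}(\tau\cdot 1)$ and descent to the quotient. *)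

(* Defs.v *)
From HB Require Import structures.
From mathcomp Require Import all_boot all_order all_algebra.
From mathcomp Require Import reals.
From mathcomp Require Import complex.
From mathcomp Require Import mpoly.

Set Implicit Arguments.
Unset Strict Implicit.
Unset Printing Implicit Defensive.

Import GRing.Theory.
Local Open Scope ring_scope.

(* Polynomials in variables indexed by a finite type J: 'X_l is the variable
   of index enum_val l. *)
Definition polyOn (C : comNzRingType) (J : finType) := {mpoly C[#|J|]}.

Definition evalOn (C : comNzRingType) (J : finType) (F : polyOn C J) (x : J -> C) : C :=
  F.@[fun l => x (enum_val l)].

Definition derivOn (C : comNzRingType) (J : finType) (v : J) (F : polyOn C J) :
    polyOn C J :=
  F^`M(enum_rank v).

Section Quadruples.
Variables (C : comUnitRingType) (k : nat).

Record quad := Quad {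
  qA : 'M[C]_k; qB : 'M[C]_k; qi : 'M[C]_(k, 2); qj : 'M[C]_(2, k) }.

Definition mu (z : quad) : 'M[C]_k :=
  qA z *m qB z - qB z *m qA z - qi z *m qj z.

Definition quad_act (g : 'M[C]_k) (z : quad) : quad :=
  Quad (g *m qA z *m invmx g) (g *m qB z *m invmx g)
       (g *m qi z) (qj z *m invmx g).

Definition quad_var : finType :=
  ('I_k * 'I_k + 'I_k * 'I_k + 'I_k * 'I_2 + 'I_2 * 'I_k)%type.

Definition varA (a b : 'I_k) : quad_var := inl (inl (inl (a, b))).
Definition varB (a b : 'I_k) : quad_var := inl (inl (inr (a, b))).
Definition vari (a : 'I_k) (c : 'I_2) : quad_var := inl (inr (a, c)).
Definition varj (c : 'I_2) (a : 'I_k) : quad_var := inr (c, a).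

Definition quad_coord (z : quad) (v : quad_var) : C :=
  match v with
  | inl (inl (inl (a, b))) => qA z a b
  | inl (inl (inr (a, b))) => qB z a b
  | inl (inr (a, c)) => qi z a c
  | inr (c, a) => qj z c a
  end.

Definition quad_eval (F : polyOn C quad_var) (z : quad) : C :=
  evalOn F (quad_coord z).

Definition quad_invariant (F : polyOn C quad_var) : Prop :=
  forall (g : 'M[C]_k) (z : quad), g \in unitmx ->
    quad_eval F (quad_act g z) = quad_eval F z.

(* The Poisson bracket of the symplectic form
     tr dA /\ dB + tr dj /\ di
       = \sum_(a, b) dA_ab /\ dB_ba + \sum_(c, a) dj_ca /\ di_ac,
   normalized by {A_ab, B_ba} = 1 and {j_ca, i_ac} = 1. *)
Definition bracket (F G : polyOn C quad_var) : polyOn C quad_var :=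
  \sum_(a < k) \sum_(b < k)
     (derivOn (varA a b) F * derivOn (varB b a) G
      - derivOn (varB b a) F * derivOn (varA a b) G)
  + \sum_(c < 2) \sum_(a < k)
     (derivOn (varj c a) F * derivOn (vari a c) G
      - derivOn (vari a c) F * derivOn (varj c a) G).

(* Both R(Q, V) and R(Q^op, V), for V = (C^k, C): an endomorphism of C^k (the
   loop), a column (the arrow from 2 to 1) and a row (the arrow from 1 to 2).
   GL(k) acts in the same way on both. *)
Record qrep := Qrep { rM : 'M[C]_k; rv : 'cV[C]_k; rw : 'rV[C]_k }.

Definition qrep_act (g : 'M[C]_k) (r : qrep) : qrep :=
  Qrep (g *m rM r *m invmx g) (g *m rv r) (rw r *m invmx g).

Definition qrep_var : finType := ('I_k * 'I_k + 'I_k + 'I_k)%type.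

Definition qrep_coord (r : qrep) (v : qrep_var) : C :=
  match v with
  | inl (inl (a, b)) => rM r a b
  | inl (inr a) => rv r a 0
  | inr a => rw r 0 a
  end.

Definition qrep_eval (F : polyOn C qrep_var) (r : qrep) : C :=
  evalOn F (qrep_coord r).

Definition qrep_invariant (F : polyOn C qrep_var) : Prop :=
  forall (g : 'M[C]_k) (r : qrep), g \in unitmx ->
    qrep_eval F (qrep_act g r) = qrep_eval F r.

(* i_1, i_2 are columns 0, 1 of i, and j_1, j_2 are rows 0, 1 of j. *)
Definition projQ (z : quad) : qrep :=
  Qrep (qA z) (col 0 (qi z)) (row 1 (qj z)).

Definition projQop (z : quad) : qrep :=
  Qrep (qB z) (col 1 (qi z)) (row 0 (qj z)).

Variable tau : C.

Definition level := {z : quad | mu z = tau%:M}.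

Definition restr (F : polyOn C quad_var) : level -> C :=
  fun x => quad_eval F (sval x).

(* C[N_(k,tau)] = C[mu^-1(tau 1)]^GL(k), as functions on mu^-1(tau 1). *)
Definition regN (f : level -> C) : Prop :=
  (exists F : polyOn C quad_var, f = restr F) /\
  (forall (g : 'M[C]_k) (x y : level), g \in unitmx ->
     sval y = quad_act g (sval x) -> f y = f x).

(* The graph of the Poisson bracket of C[N_(k,tau)]: poissonN f g h means
   {f, g} = h.  Over the complex numbers every element of C[N_(k,tau)] has an
   invariant polynomial lift because GL(k) is reductive, and h does not depend
   on the lifts because the Hamiltonian flow of an invariant function
   preserves mu^-1(tau 1). *)
Definition poissonN (f g h : level -> C) : Prop :=
  exists F G : polyOn C quad_var,
    [/\ quad_invariant F, quad_invariant G,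
        f = restr F, g = restr G & h = restr (bracket F G)].

Record subalgN (S : (level -> C) -> Prop) : Prop := SubalgN {
  subalgN_reg : forall f, S f -> regN f;
  subalgN_cst : forall c : C, S (fun _ => c);
  subalgN_add : forall f g, S f -> S g -> S (fun x => f x + g x);
  subalgN_mul : forall f g, S f -> S g -> S (fun x => f x * g x) }.

Definition poisson_subalgN (S : (level -> C) -> Prop) : Prop :=
  subalgN S /\ forall f g h, S f -> S g -> poissonN f g h -> S h.

(* A subalgebra on which the Poisson bracket vanishes (hence closed under it). *)
Definition commutative_poisson_subalgN (S : (level -> C) -> Prop) : Prop :=
  subalgN S /\ forall f g, S f -> S g -> poissonN f g (fun _ => 0).

Definition poisson_generatedN (G : (level -> C) -> Prop) (f : level -> C) : Prop :=
  forall S : (level -> C) -> Prop,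
    poisson_subalgN S -> (forall g, G g -> S g) -> S f.

(* C[R(Q, V)]^GL(k) and C[R(Q^op, V)]^GL(k), as functions on N_(k,tau). *)
Definition invQ (f : level -> C) : Prop :=
  exists2 F : polyOn C qrep_var, qrep_invariant F &
    f = fun x => qrep_eval F (projQ (sval x)).

Definition invQop (f : level -> C) : Prop :=
  exists2 F : polyOn C qrep_var, qrep_invariant F &
    f = fun x => qrep_eval F (projQop (sval x)).

End Quadruples.

(* Main.v *)
Require Import Defs.
From mathcomp Require Import all_boot all_order all_algebra.
From mathcomp Require Import reals.
From mathcomp Require Import complex.
From mathcomp Require Import all_fingroup boolp mpoly ring zify.

(** The coordinates (A, i_1, j_2) pairwise Poisson commute, and so do (B, i_2, j_1);
hence both families of functions have vanishing brackets.  The bracket of two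
invariant polynomials is invariant because GL(k) acts by symplectic linear maps
(bracket_invariant), so that the regular functions form a Poisson subalgebra.
What remains is to produce every regular function from the two families, and
this has an invariant-theoretic half and a symplectic half.

Invariant theory (regN_subalgebra): every regular function is a polynomial in
the functions tr w(A, B) and j_c w(A, B) i_d, where w runs over words in two
letters.  Scalar matrices rescale i and j in opposite directions, so only the
monomials with as many entries of i as of j contribute to the values of an
invariant function (balanced_part).  Such a monomial is a product of entries of
the matrices 1, A, B and i_c j_d, on all of which GL(k) acts by simultaneous
conjugation (tensor_form).  For functions of a tuple of matrices which are
constant under simultaneous conjugation, consider the coefficient vector in the
tensor power.  The matrices by which GL(k) acts there are stable under
conjugate transposition, and an orthogonal projection replaces the vector by an
invariant one without changing the values (invariant_part); this plays the role
of averaging over the unitary group.  By Schur-Weyl duality (schur_weyl), an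
invariant tensor is a combination of permutations of the tensor slots, and
contracting with a permutation gives a product of traces of words, one for each
cycle (loop_contraction).  All of this is done with the values at the points of
the level set of mu, where the function is invariant; an invariant polynomial
which lifts it comes out at the end.

Poisson brackets (S_jwi, S_trw): on the level set AB = BA + ij + tau, so two
words which differ by the order of their letters give functions that differ by
polynomials in functions of shorter words (word_swap).  By induction on the
length it suffices to reach one word with p letters A and q letters B, for all
p and q, and this is what brackets provide:
  {tr A^(p+1), tr B^(q+1)} = (p+1)(q+1) tr B^q A^p,
  {tr A^(p+1), j_c B^(q+1) i_d} = (p+1) sum_r j_c B^r A^p B^(q-r) i_d.
The second formula needs j_c B^q i_d for all c and d, while only the entry
j_1 B^q i_2 of this 2x2 matrix is given.  The bracket with j_2 i_1 acts on the
matrix as the commutator with an elementary nilpotent matrix, so that applying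
it twice gives the difference of the diagonal entries and the other
off-diagonal entry; the sum of the diagonal entries is the trace of B^q ij,
which equals - tau tr B^q (S_jBi).

In the code, the indices 1, 2 of i and j become 0, 1, and a word is a sequence
of booleans in which false stands for A and true for B. *)

Set Implicit Arguments.
Unset Strict Implicit.
Unset Printing Implicit Defensive.

Import Order.TTheory GRing.Theory Num.Theory.
Local Open Scope ring_scope.

(** * Invariant vectors in an affine span *)

Section InvariantPart.
Variable C : numClosedFieldType.

Definition conjT m n (A : 'M[C]_(m, n)) : 'M[C]_(n, m) := map_mx Num.conj A^T.

Lemma conjTK m n (A : 'M[C]_(m, n)) : conjT (conjT A) = A.
Proof. by apply/matrixP => i j; rewrite !mxE conjCK. Qed.

Lemma conjT_mul m n p (A : 'M[C]_(m, n)) (B : 'M_(n, p)) :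
  conjT (A *m B) = conjT B *m conjT A.
Proof. by rewrite /conjT trmx_mul map_mxM. Qed.

Lemma mul_conjT_eq0 n (v : 'rV[C]_n) : v *m conjT v = 0 -> v = 0.
Proof.
move=> /matrixP /(_ 0 0); rewrite !mxE => h.
have {h} /psumr_eq0P h : \sum_j `|v 0 j| ^+ 2 = 0.
  by rewrite -[RHS]h; apply: eq_bigr => j _; rewrite !mxE normCK.
apply/rowP => j; rewrite mxE; apply/eqP.
rewrite -normr_eq0 -sqrf_eq0; apply/eqP/h => // i _.
by rewrite exprn_ge0.
Qed.

(** A basis B of the row space of W has an invertible Gram matrix, because the
    norm vanishes on the zero vector only; this gives the orthogonal projection
    in closed form. *)
Lemma orthogonal_decomposition n (W : 'M[C]_n) (v : 'rV[C]_n) :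
  exists v1 v0 : 'rV[C]_n, [/\ v = v1 + v0, (v1 <= W)%MS & v0 *m conjT W = 0].
Proof.
move: (row_base W) (eq_row_base W) (row_base_free W) => B eB fB.
have uG : B *m conjT B \in unitmx.
  rewrite -row_free_unit -kermx_eq0; apply/rowV0P => u.
  move=> /sub_kermxP; rewrite mulmxA => hu.
  have : u *m B = 0.
    by apply: mul_conjT_eq0; rewrite conjT_mul mulmxA hu mul0mx.
  move=> uB; apply: (row_free_inj fB).
  by rewrite uB mul0mx.
exists (v *m conjT B *m invmx (B *m conjT B) *m B).
exists (v - v *m conjT B *m invmx (B *m conjT B) *m B); split.
- by rewrite addrC subrK.
- by rewrite -eB submxMl.
- have /submxP [D e] : (W <= B)%MS by rewrite eB.
  have -> : conjT W = conjT B *m conjT D by rewrite -conjT_mul -e.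
  rewrite mulmxBl -!mulmxA.
  by rewrite (mulmxA B) (mulmxA (invmx _)) mulVmx // mul1mx subrr.
Qed.

(** The family may be infinite, and W is found as a matrix of maximal rank among
    those killed by every column that kills the family.  The second clause says
    that the row space of W is not larger than the span. *)
Lemma span_family n (Q : 'rV[C]_n -> Prop) :
  exists W : 'M[C]_n, (forall u, Q u -> (u <= W)%MS) /\
    (forall D : 'cV[C]_n, (forall u, Q u -> u *m D = 0) -> W *m D = 0).
Proof.
pose good (W : 'M[C]_n) :=
  forall D : 'cV[C]_n, (forall u, Q u -> u *m D = 0) -> W *m D = 0.
pose P r := `[< exists W, good W /\ \rank W = r >].
have exP : exists r, P r.
  by exists 0%N; apply/asboolP; exists 0; split; rewrite ?mxrank0 // => D _; rewrite mul0mx.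
have ubP r : P r -> (r <= n)%N.
  by move=> /asboolP [W [_ <-]]; rewrite rank_leq_row.
case: (ex_maxnP exP ubP) => r /asboolP [W [gW rW]] maxr.
exists W; split=> // u Qu.
have gWu : good (W + u)%MS.
  move=> D hD; apply/eqP.
  have : (W + u <= kermx D)%MS.
    by rewrite addsmx_sub; apply/andP; split; apply/sub_kermxP; [apply: gW | apply: hD].
  by move/sub_kermxP => ->.
have : (\rank (W + u)%MS <= \rank W)%N.
  by rewrite rW; apply: maxr; apply/asboolP; exists (W + u)%MS.
move=> le.
have e : (W + u <= W)%MS.
  by rewrite -(mxrank_leqif_sup (addsmxSl W u)) eqn_leq le mxrankS ?addsmxSl.
exact: submx_trans (addsmxSr W u) e.
Qed.

(** Projecting v orthogonally to the span W of all v g - v gives a fixed vector: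
    W is stable under Gs, hence so is its orthogonal complement since Gs is
    stable under adjoints, and the vector v0 g - v0 lies in both.  As v - v0 is
    in W, a functional with the same value at all v g has that value at v0. *)
Lemma invariant_part n (Gs : 'M[C]_n -> Prop) (v : 'rV[C]_n) :
    (forall g h, Gs g -> Gs h -> Gs (g *m h)) ->
    (forall g, Gs g -> Gs (conjT g)) ->
  exists2 v0 : 'rV[C]_n, (forall g, Gs g -> v0 *m g = v0) &
    forall D : 'cV[C]_n, (forall g, Gs g -> v *m g *m D = v *m D) -> v0 *m D = v *m D.
Proof.
move=> GM GC.
have [W [WQ QW]] := span_family (fun u => exists2 g, Gs g & u = v *m g - v).
have [v1 [v0 [vE v1W v0W]]] := orthogonal_decomposition W v.
have WG g : Gs g -> (W *m g <= W)%MS.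
  move=> Gg; rewrite submxE; apply/eqP/matrixP => i j.
  have : W *m (g *m col j (cokermx W)) = 0.
    apply: QW => u [h Gh ->].
    rewrite mulmxA mulmxBl -mulmxA.
    have -> : v *m (h *m g) - v *m g = (v *m (h *m g) - v) - (v *m g - v).
      by rewrite opprB addrA subrK.
    rewrite mulmxBl.
    have kil x : Gs x -> (v *m x - v) *m col j (cokermx W) = 0.
      move=> Gx; have /submxP [K ->] : (v *m x - v <= W)%MS by apply: WQ; exists x.
      by rewrite colE -mulmxA [W *m _]mulmxA mulmx_coker !(mul0mx, mulmx0).
    by rewrite !kil ?subrr //; apply: GM.
  move=> /matrixP /(_ i 0); rewrite colE !mulmxA -colE.
  by rewrite [LHS]mxE => ->; rewrite !mxE.
exists v0 => [g Gg|D hD].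
  apply/eqP; rewrite -subr_eq0; apply/eqP.
  set d := _ - _.
  (* d lies in W and is orthogonal to W. *)
  have dW : (d <= W)%MS.
    have -> : d = (v *m g - v) - (v1 *m g - v1).
      rewrite /d vE mulmxDl; move: (v0 *m g) (v1 *m g) => x y.
      by apply/rowP => j; rewrite !mxE; ring.
    rewrite addmx_sub //; first by apply: WQ; exists g.
    rewrite eqmx_opp addmx_sub ?eqmx_opp //.
    have /submxP [K ->] := v1W; rewrite -mulmxA.
    exact: submx_trans (submxMl _ _) (WG _ Gg).
  have dWC : d *m conjT W = 0.
    rewrite /d mulmxBl v0W subr0 -mulmxA -[g]conjTK -conjT_mul.
    have /submxP [K ->] := WG _ (GC _ Gg).
    by rewrite conjT_mul mulmxA v0W mul0mx.
  apply: mul_conjT_eq0; have /submxP [K {2}->] := dW.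
  by rewrite conjT_mul mulmxA dWC mul0mx.
rewrite vE mulmxDl.
have /submxP [K ->] := v1W.
rewrite -mulmxA QW ?mulmx0 ?add0r // => u [g Gg ->].
by rewrite mulmxBl hD // subrr.
Qed.

End InvariantPart.

(** * The double commutant of a finite group *)

Section DoubleCommutant.
Variables (C : numFieldType) (gT : finGroupType) (n : nat).
Variable P : gT -> 'M[C]_n.
Hypothesis P1 : P 1%g = 1%:M.
Hypothesis PM : forall s t, P (s * t)%g = P s *m P t.

Definition in_span (M : 'M[C]_n) := exists w : gT -> C, M = \sum_s w s *: P s.

Let in_spanP s M : in_span M -> in_span (P s *m M).
Proof.
move=> [w ->]; exists (fun t => w (s^-1 * t)%g).
rewrite mulmx_sumr [RHS](reindex_inj (mulgI s)) /=.
by apply: eq_bigr => t _; rewrite mulKg PM scalemxAr.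
Qed.

Let in_span_sum c I (r : seq I) (F : I -> 'M_n) :
  (forall i, in_span (F i)) -> in_span (c *: \sum_(i <- r) F i).
Proof.
move=> FS; elim: r => [|i r [w IH]].
  exists (fun _ => 0); rewrite big_nil scaler0 big1 // => s _.
  by rewrite scale0r.
have [wi Ei] := FS i.
exists (fun s => c * wi s + w s); rewrite big_cons scalerDr IH Ei scaler_sumr -big_split /=.
by apply: eq_bigr => s _; rewrite scalerDl scalerA.
Qed.

(** The map p is a linear projection of the matrix space onto the span of the
    image of P, and q is its average over the group, in the style of Maschke. *)
Let B : 'M[C]_(#|gT|, n * n) := \matrix_s mxvec (P (enum_val s)).
Let p (M : 'M[C]_n) : 'M[C]_n := vec_mx (mxvec M *m (pinvmx B *m B)).

Let p_lin a X Y : p (a *: X + Y) = a *: p X + p Y.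
Proof. by rewrite /p linearP mulmxDl -scalemxAl linearP. Qed.

Let p_span M : in_span (p M).
Proof.
rewrite /p mulmxA mulmx_sum_row linear_sum /=.
move: (mxvec M *m _) => u.
exists (fun s => u 0 (enum_rank s)).
rewrite [RHS](reindex_onto enum_val enum_rank) => [|i _]; last exact: enum_rankK.
apply: eq_big => [i|i _]; first by rewrite enum_valK eqxx.
by rewrite linearZ /= rowK mxvecK enum_valK.
Qed.

Let pP s : p (P s) = P s.
Proof.
rewrite /p mulmxA mulmxKpV ?mxvecK //.
by have := row_sub (enum_rank s) B; rewrite rowK enum_rankK.
Qed.

Let q (M : 'M[C]_n) : 'M[C]_n := #|gT|%:R^-1 *: \sum_s P s^-1%g *m p (P s *m M).

Let cardG_neq0 : #|gT|%:R != 0 :> C.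
Proof. by rewrite pnatr_eq0 -lt0n; apply/card_gt0P; exists 1%g. Qed.

Let q_lin a X Y : q (a *: X + Y) = a *: q X + q Y.
Proof.
rewrite /q scalerA mulrC -scalerA -scalerDr; congr (_ *: _).
rewrite scaler_sumr -big_split /=; apply: eq_bigr => s _.
by rewrite mulmxDr -scalemxAr p_lin mulmxDr -scalemxAr.
Qed.

Let q_sum I (r : seq I) (c : I -> C) (F : I -> 'M_n) :
  q (\sum_(i <- r) c i *: F i) = \sum_(i <- r) c i *: q (F i).
Proof.
elim: r => [|i r IH]; last by rewrite !big_cons q_lin IH.
rewrite !big_nil; have := q_lin (-1) 0 0.
by rewrite !scaleN1r oppr0 addr0 addNr.
Qed.

Let q_span M : in_span (q M).
Proof. by apply: in_span_sum => s; apply/in_spanP/p_span. Qed.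

Let q1 : q 1%:M = 1%:M.
Proof.
rewrite /q (eq_bigr (fun _ => 1%:M)) => [|s _].
  by rewrite sumr_const -scaler_nat scalerA mulVf // scale1r.
by rewrite mulmx1 pP -PM mulVg P1.
Qed.

Let qP t M : q (P t *m M) = P t *m q M.
Proof.
rewrite /q -scalemxAr mulmx_sumr; congr (_ *: _).
rewrite [LHS](reindex_inj (mulIg t^-1%g)) /=; apply: eq_bigr => s _.
by rewrite invMg invgK [P (t * _)%g]PM [P (s * _)%g *m _]mulmxA -(PM (s * _)%g) mulgKV mulmxA.
Qed.

(** The averaged projection q commutes with left multiplication by each P s.
    So, with y and v held fixed, the matrix of the coefficients of q that link
    column v of the argument to column y of the value is in the commutant.  It
    thus commutes with Phi, which means q (Phi M) = Phi q M for all M, and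
    M = 1 shows that Phi = q Phi is in the span. *)
Lemma double_commutant (Phi : 'M[C]_n) :
    (forall M, (forall s, P s *m M = M *m P s) -> Phi *m M = M *m Phi) ->
  in_span Phi.
Proof.
move=> PhiC.
have qPhi_delta u v : q (Phi *m delta_mx u v) = Phi *m q (delta_mx u v).
  have colE' (X : 'M[C]_n) (a b : 'I_n) :
      X *m delta_mx a b = \sum_c X c a *: delta_mx c b.
    apply/matrixP => x y; rewrite mxE summxE (bigD1 a) //= big1 => [|i ia].
      rewrite (bigD1 x) //= [X in _ = _ + X]big1 => [|i ix]; first by rewrite !mxE !eqxx.
      by rewrite !mxE eq_sym (negbTE ix) mulr0.
    by rewrite !mxE (negbTE ia) mulr0.
  apply/matrixP => x y.
  (* the coefficients of q from column v to column y *)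
  pose Q := \matrix_(a, b) q (delta_mx b v) a y.
  have QP s : P s *m Q = Q *m P s.
    apply/matrixP => a b.
    transitivity ((P s *m q (delta_mx b v)) a y).
      by rewrite !mxE; apply: eq_bigr => c _; rewrite !mxE.
    rewrite -qP colE' q_sum summxE mxE; apply: eq_bigr => c _.
    by rewrite !mxE mulrC.
  rewrite colE' q_sum summxE.
  transitivity ((Q *m Phi) x u).
    by rewrite mxE; apply: eq_bigr => c _; rewrite !mxE mulrC.
  rewrite -PhiC // !mxE; apply: eq_bigr => c _; by rewrite !mxE.
have e1 : 1%:M = \sum_i (1 : C) *: delta_mx i i :> 'M_n.
  by rewrite mx1_sum_delta; apply: eq_bigr => i _; rewrite scale1r.
suff -> : Phi = q Phi by [].
transitivity (Phi *m q 1%:M); first by rewrite q1 mulmx1.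
transitivity (q (Phi *m 1%:M)); last by rewrite mulmx1.
rewrite e1 q_sum !mulmx_sumr [in RHS](eq_bigr (fun i => 1 *: (Phi *m delta_mx i i))).
  by rewrite q_sum; apply: eq_bigr => i _; rewrite qPhi_delta scalemxAr.
by move=> i _; rewrite scalemxAr.
Qed.

End DoubleCommutant.

(** * Schur-Weyl duality *)

Section TensorPower.
Variables (C : comNzRingType) (k N : nat).
Implicit Types (a b c : {ffun 'I_N -> 'I_k}) (g h : 'M[C]_k).

Definition tensor_prod (X : 'I_N -> 'M[C]_k) a b : C := \prod_s X s (a s) (b s).

Definition tensor_power g := tensor_prod (fun _ => g).

Lemma tensor_prodM (X Y : 'I_N -> 'M[C]_k) a b :
  \sum_c tensor_prod X a c * tensor_prod Y c b = tensor_prod (fun s => X s *m Y s) a b.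
Proof.
rewrite /tensor_prod; under [RHS]eq_bigr do rewrite mxE.
by rewrite bigA_distr_bigA; apply: eq_bigr => c _; rewrite big_split.
Qed.

Lemma tensor_powerM g h a b :
  \sum_c tensor_power g a c * tensor_power h c b = tensor_power (g *m h) a b.
Proof. exact: tensor_prodM. Qed.

Lemma tensor_power1 a b : tensor_power 1%:M a b = (a == b)%:R.
Proof.
rewrite /tensor_power /tensor_prod; case: eqP => [->|ab].
  by rewrite big1 // => s _; rewrite mxE eqxx.
have [s abs] : exists s, a s != b s.
  apply/existsP; rewrite -negb_forall; apply/negP => /forallP H.
  by apply: ab; apply/ffunP => s; apply/eqP.
by rewrite (bigD1 s) //= mxE (negbTE abs) mul0r.
Qed.

End TensorPower.

Definition slot_perm k N (s : 'S_N) (a : {ffun 'I_N -> 'I_k}) : {ffun 'I_N -> 'I_k} :=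
  [ffun i => a (s i)].

Lemma slot_permM k N (s t : 'S_N) (a : {ffun 'I_N -> 'I_k}) :
  slot_perm (s * t)%g a = slot_perm s (slot_perm t a).
Proof. by apply/ffunP => i; rewrite !ffunE permM. Qed.

Lemma slot_perm1 k N (a : {ffun 'I_N -> 'I_k}) : slot_perm 1%g a = a.
Proof. by apply/ffunP => i; rewrite !ffunE perm1. Qed.

Lemma slot_perm_inj k N (s : 'S_N) : injective (@slot_perm k N s).
Proof.
apply: (can_inj (g := slot_perm s^-1%g)) => a.
by rewrite -slot_permM mulVg slot_perm1.
Qed.

Lemma poly_nat_roots_eq0 (C : numDomainType) (p : {poly C}) :
  (forall n : nat, p.[n%:R] = 0) -> p = 0.
Proof.
move=> p0.
apply: (@roots_geq_poly_eq0 _ _ [seq i%:R | i <- iota 0 (size p)]).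
- by apply/allP => _ /mapP[i _ ->]; apply/rootP.
- rewrite map_inj_uniq ?iota_uniq // => i j /eqP.
  by rewrite eqr_nat => /eqP.
- by rewrite size_map size_iota.
Qed.

Section Polarization.
Variables (C : numFieldType) (k N : nat).
Local Notation J := {ffun 'I_N -> 'I_k}.
Variable psi : J -> J -> C.

(** Zariski density of GL(k): along the line m + t the expression is a
    polynomial in t, whose product with the determinant vanishes identically. *)
Lemma vanish_on_matrices :
    (forall g, g \in unitmx -> \sum_a \sum_b psi a b * tensor_power g a b = 0) ->
  forall m, \sum_a \sum_b psi a b * tensor_power m a b = 0.
Proof.
move=> psi0 m.
pose p := \sum_a \sum_b (psi a b)%:P *
            tensor_power ('X%:M + map_mx polyC m) a b.
pose q := char_poly (- m).
have tpt t a b : (tensor_power ('X%:M + map_mx polyC m) a b).[t]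
                 = tensor_power (t%:M + m) a b.
  rewrite /tensor_power /tensor_prod -horner_evalE rmorph_prod; apply: eq_bigr => s _.
  by rewrite !mxE /= horner_evalE hornerD hornerMn hornerX hornerC.
have pt t : p.[t] = \sum_a \sum_b psi a b * tensor_power (t%:M + m) a b.
  rewrite /p -horner_evalE rmorph_sum; apply: eq_bigr => a _.
  rewrite rmorph_sum; apply: eq_bigr => b _.
  by rewrite /= horner_evalE hornerM hornerC tpt.
have qt t : q.[t] = \det (t%:M + m).
  rewrite -horner_evalE /q /char_poly -det_map_mx; congr (\det _).
  apply/matrixP => i j; rewrite !mxE /= horner_evalE.
  by rewrite hornerD hornerMn hornerX hornerN hornerC opprK.
have pq0 : p * q = 0.
  apply: poly_nat_roots_eq0 => t; rewrite hornerM.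
  have [u|nu] := boolP ((t%:R%:M + m) \in unitmx).
    by rewrite pt psi0 // mul0r.
  by move: nu; rewrite unitmxE unitfE negbK -qt => /eqP ->; rewrite mulr0.
have p0 : p = 0.
  apply/eqP; move/eqP: pq0; rewrite mulf_eq0 => /orP [] // /eqP q0.
  have := char_poly_monic (- m); rewrite -/q q0 monicE lead_coef0 eq_sym.
  by rewrite oner_eq0.
by have := pt 0; rewrite p0 horner0 raddf0 add0r => <-.
Qed.

Hypothesis psi0 : forall m, \sum_a \sum_b psi a b * tensor_power m a b = 0.

Let pull (h : {ffun 'I_N -> 'I_N}) (a : J) : J := [ffun s => a (h s)].

(** The hypothesis for the sum, over the slots t in S, of the elementary matrices
    at position (a0 t, b0 t), expanded by multilinearity. *)
Let sum_subset (a0 b0 : J) (S : {set 'I_N}) :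
  \sum_(h in ffun_on (mem S)) psi (pull h a0) (pull h b0) = 0.
Proof.
pose m : 'M[C]_k :=
  \matrix_(x, y) \sum_(t in S) ((a0 t == x) && (b0 t == y))%:R.
rewrite -[RHS](psi0 m).
have tpm a b : tensor_power m a b =
    \sum_(h in ffun_on (mem S)) ((pull h a0 == a) && (pull h b0 == b))%:R.
  rewrite /tensor_power /tensor_prod; under eq_bigr do rewrite mxE.
  rewrite bigA_distr_big; apply: eq_bigr => h _.
  have [/andP[/eqP <- /eqP <-]|ne] := boolP (_ && _).
    by rewrite big1 // => s _; rewrite !ffunE !eqxx.
  have [s abs] : exists s, ~~ ((a0 (h s) == a s) && (b0 (h s) == b s)).
    apply/existsP; rewrite -negb_forall; apply: contra ne => /forallP H.
    apply/andP; split; apply/eqP/ffunP => s; rewrite ffunE;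
    by case/andP: (H s) => /eqP ? /eqP ?.
  by rewrite (bigD1 s) //= (negbTE abs) mul0r.
under [RHS]eq_bigr do under eq_bigr do rewrite tpm mulr_sumr.
under [RHS]eq_bigr do rewrite exchange_big /=.
rewrite exchange_big /=; apply: eq_bigr => h _.
rewrite (bigD1 (pull h a0)) //= (bigD1 (pull h b0)) //= !eqxx mulr1.
rewrite big1 => [|b /negbTE bb]; last by rewrite eq_sym bb mulr0.
rewrite big1 => [|a /negbTE aa]; first by rewrite !addr0.
by rewrite big1 // => b _; rewrite eq_sym aa mulr0.
Qed.

(** Moebius inversion over the lattice of subsets, as an induction on U. *)
Let sum_image (a0 b0 : J) (U : {set 'I_N}) :
  \sum_(h : {ffun 'I_N -> 'I_N} | h @: setT == U)
     psi (pull h a0) (pull h b0) = 0.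
Proof.
have [n] := ubnP #|U|; elim: n U => // n IH U leU.
have := sum_subset a0 b0 U.
rewrite (partition_big (fun h : {ffun 'I_N -> 'I_N} => h @: setT)
                       (fun V => V \subset U)) /=; last first.
  move=> h /ffun_onP hU; apply/subsetP => _ /imsetP [s _ ->]; exact: hU.
rewrite (bigD1 U) //= [X in _ + X]big1 ?addr0 => [e|V /andP[VU neV]].
  rewrite -[RHS]e; apply: eq_bigl => h; case: eqP => [<-|_]; last by rewrite andbF.
  by rewrite andbT; apply/esym/ffun_onP => s; apply: imset_f.
have ltVU : (#|V| < n)%N.
  have : V \proper U by rewrite properEneq neV.
  by move=> /proper_card /leq_trans; apply.
rewrite -[RHS](IH V ltVU); apply: eq_bigl => h.
case: eqP => [e|_]; last by rewrite andbF.
rewrite andbT; apply/ffun_onP => s; apply: (subsetP VU).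
by rewrite -e; apply: imset_f.
Qed.

(** The case of maps with full image, which are the permutations. *)
Lemma sum_slot_perm_eq0 (a0 b0 : J) :
  \sum_(s : 'S_N) psi (slot_perm s a0) (slot_perm s b0) = 0.
Proof.
rewrite -[RHS](sum_image a0 b0 setT).
have injE (h : {ffun 'I_N -> 'I_N}) : (h @: setT == setT) = injectiveb h.
  apply/eqP/injectiveP => [e|hi].
    have /imset_injP hi : #|h @: setT| == #|[set: 'I_N]| by rewrite e.
    by move=> x y; apply: hi; rewrite inE.
  apply/eqP; rewrite eqEcard subsetT /=.
  by rewrite card_imset.
rewrite (reindex_onto (fun s : 'S_N => val s) (insubd (1%g : 'S_N))) /=; last first.
  by move=> h; rewrite injE => hi; rewrite insubdK.
apply: eq_big => [s|s _].
  by rewrite injE valKd eqxx andbT (valP s).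
by congr psi; apply/ffunP => i; rewrite !ffunE pvalE.
Qed.

(** The powers of matrices span the symmetric tensors: a functional psi that
    vanishes on all of them has zero sum over every orbit of slot permutations,
    and M is constant on these orbits. *)
Lemma polarization (M : J -> J -> C) :
    (forall (s : 'S_N) a b, M (slot_perm s a) (slot_perm s b) = M a b) ->
  \sum_a \sum_b psi a b * M a b = 0.
Proof.
move=> MS; apply/eqP; have : #|'S_N|%:R != 0 :> C.
  by rewrite pnatr_eq0 -lt0n; apply/card_gt0P; exists 1%g.
move/mulfI/inj_eq <-; rewrite mulr0; apply/eqP.
rewrite mulr_natl -sumr_const.
rewrite (eq_bigr (fun s : 'S_N => \sum_a \sum_b
    psi (slot_perm s a) (slot_perm s b) * M a b)) => [|s _]; last first.
  rewrite (reindex_inj (@slot_perm_inj _ _ s)); apply: eq_bigr => a _.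
  rewrite (reindex_inj (@slot_perm_inj _ _ s)); apply: eq_bigr => b _.
  by rewrite MS.
rewrite exchange_big big1 //= => a _; rewrite exchange_big big1 //= => b _.
by rewrite -mulr_suml sum_slot_perm_eq0 mul0r.
Qed.

End Polarization.

Section SchurWeyl.
Variables (C : numFieldType) (k N : nat).
Local Notation J := {ffun 'I_N -> 'I_k}.

(** By polarization, Phi commutes with every matrix that commutes with the
    permutations of the slots, so the double commutant theorem applies to the
    group of slot permutations. *)
Lemma schur_weyl (Phi : J -> J -> C) :
    (forall g, g \in unitmx -> forall a b,
       \sum_c Phi a c * tensor_power g c b = \sum_c tensor_power g a c * Phi c b) ->
  exists w : 'S_N -> C,
    forall a b, Phi a b = \sum_s w s * (a == slot_perm s b)%:R.
Proof.
move=> Phi_g.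
pose P (s : 'S_N) : 'M[C]_#|J| :=
  \matrix_(i, j) (enum_val i == slot_perm s (enum_val j))%:R.
have P1 : P 1%g = 1%:M.
  apply/matrixP => i j; rewrite !mxE slot_perm1.
  by rewrite (inj_eq enum_val_inj).
have sumJ (F : 'I_#|J| -> C) : \sum_i F i = \sum_a F (enum_rank a).
  by rewrite (reindex _ (onW_bij _ (@enum_rank_bij _))).
have PM s t : P (s * t)%g = P s *m P t.
  apply/matrixP => i j; rewrite !mxE sumJ.
  rewrite (bigD1 (slot_perm t (enum_val j))) //= big1 => [|a /negbTE ne].
    by rewrite !mxE enum_rankK eqxx mulr1 addr0 slot_permM.
  by rewrite !mxE enum_rankK ne mulr0.
pose F : 'M[C]_#|J| := \matrix_(i, j) Phi (enum_val i) (enum_val j).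
have [M PC|w Fw] := @double_commutant C _ _ P P1 PM F; last first.
  exists w => a b.
  have /matrixP /(_ (enum_rank a) (enum_rank b)) := Fw.
  rewrite mxE !enum_rankK => ->; rewrite summxE; apply: eq_bigr => s _.
  by rewrite !mxE !enum_rankK.
pose M' (a b : J) := M (enum_rank a) (enum_rank b).
have M'S s a b : M' (slot_perm s a) (slot_perm s b) = M' a b.
  have /matrixP /(_ (enum_rank (slot_perm s a)) (enum_rank b)) := PC s.
  rewrite !mxE !sumJ (bigD1 a) //= [X in _ + X]big1 => [|c /negbTE ne]; last first.
    by rewrite mxE !enum_rankK (inj_eq (@slot_perm_inj _ _ s)) eq_sym ne mul0r.
  rewrite !mxE !enum_rankK eqxx mul1r addr0 /M' => ->.
  rewrite (bigD1 (slot_perm s b)) //= big1 => [|c /negbTE ne]; last first.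
    by rewrite mxE !enum_rankK ne mulr0.
  by rewrite mxE !enum_rankK eqxx mulr1 addr0.
apply/matrixP => i j.
pose x := enum_val i; pose y := enum_val j.
(* the entry (x, y) of the commutator with Phi, as a functional *)
pose psi (a b : J) := Phi x a * (b == y)%:R - (a == x)%:R * Phi b y.
have psiE (G : J -> J -> C) : \sum_a \sum_b psi a b * G a b =
    \sum_c Phi x c * G c y - \sum_c G x c * Phi c y.
  rewrite /psi.
  under eq_bigr do under eq_bigr do rewrite mulrBl.
  under eq_bigr do rewrite sumrB.
  rewrite sumrB; congr (_ - _).
    apply: eq_bigr => a _; rewrite (bigD1 y) //= big1 => [|b /negbTE ne].
      by rewrite eqxx mulr1 addr0.
    by rewrite ne mulr0 mul0r.
  rewrite (bigD1 x) //= [X in _ + X]big1 => [|a /negbTE ne].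
    by rewrite addr0; apply: eq_bigr => c _; rewrite eqxx mul1r mulrC.
  by rewrite big1 // => b _; rewrite ne !mul0r.
have vanish : \sum_a \sum_b psi a b * M' a b = 0.
  apply: polarization M'S; apply: vanish_on_matrices => g ug.
  by rewrite psiE Phi_g // subrr.
rewrite psiE in vanish; rewrite !mxE !sumJ.
apply/eqP; rewrite -subr_eq0; apply/eqP; rewrite -[RHS]vanish.
by congr (_ - _); apply: eq_bigr => c _; rewrite !mxE enum_rankK /M' enum_valK.
Qed.

End SchurWeyl.

(** * Contracting permutations to traces of words *)

Definition word_mx (C : pzRingType) k (Lab : Type) (X : Lab -> 'M[C]_k) (w : seq Lab) :
  'M[C]_k := foldr (fun l M => X l *m M) 1%:M w.

Lemma word_mx_cat (C : pzRingType) k Lab (X : Lab -> 'M[C]_k) u w :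
  word_mx X (u ++ w) = word_mx X u *m word_mx X w.
Proof. by elim: u => [|l u IH] /=; rewrite ?mul1mx // IH mulmxA. Qed.

Lemma word_mx_nseq (C : pzRingType) k Lab (X : Lab -> 'M[C]_k) l n :
  word_mx X (nseq n l) = iter n (mulmx (X l)) 1%:M.
Proof. by elim: n => //= n ->. Qed.

Lemma word_mx_conj (C : comUnitRingType) k Lab (X : Lab -> 'M[C]_k) g w :
  g \in unitmx ->
  word_mx (fun l => g *m X l *m invmx g) w = g *m word_mx X w *m invmx g.
Proof.
move=> ug; elim: w => [|l w IH] /=; first by rewrite mulmx1 mulmxV.
by rewrite IH !mulmxA mulmxKV.
Qed.

Record subalgebra (C : pzRingType) (Omega : Type) (D : (Omega -> C) -> Prop) : Prop :=
  Subalgebra {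
    subalg_cst : forall c, D (fun _ => c);
    subalg_add : forall f g, D f -> D g -> D (fun x => f x + g x);
    subalg_mul : forall f g, D f -> D g -> D (fun x => f x * g x) }.

Section SubalgebraTheory.
Variables (C : pzRingType) (Omega : Type) (D : (Omega -> C) -> Prop).
Hypothesis DA : subalgebra D.

Lemma subalg_eq f g : D g -> f =1 g -> D f.
Proof. by move=> Dg /funext ->. Qed.

Lemma subalg_scale c f : D f -> D (fun x => c * f x).
Proof. by move=> Df; apply: (subalg_mul DA (subalg_cst DA c)). Qed.

Lemma subalg_opp f : D f -> D (fun x => - f x).
Proof.
by move=> Df; apply: subalg_eq (subalg_scale (-1) Df) _ => x; rewrite mulN1r.
Qed.

Lemma subalg_sub f g : D f -> D g -> D (fun x => f x - g x).
Proof. by move=> Df Dg; apply: (subalg_add DA Df (subalg_opp Dg)). Qed.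

Lemma subalg_sum I (r : seq I) (F : I -> Omega -> C) :
  (forall i, D (F i)) -> D (fun x => \sum_(i <- r) F i x).
Proof.
move=> DF; elim: r => [|i r IH].
  by apply: subalg_eq (subalg_cst DA 0) _ => x; rewrite big_nil.
by apply: subalg_eq (subalg_add DA (DF i) IH) _ => x; rewrite big_cons.
Qed.

End SubalgebraTheory.

Section FfunCons.
Variables (T : finType) (N : nat).

Definition ffun_cons (p : T * {ffun 'I_N -> T}) : {ffun 'I_N.+1 -> T} :=
  [ffun i => oapp p.2 p.1 (unlift ord0 i)].

Lemma ffun_cons0 p : ffun_cons p ord0 = p.1.
Proof. by rewrite ffunE unlift_none. Qed.

Lemma ffun_consS p i : ffun_cons p (lift ord0 i) = p.2 i.
Proof. by rewrite ffunE liftK. Qed.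

Lemma ffun_cons_bij : bijective ffun_cons.
Proof.
exists (fun b : {ffun 'I_N.+1 -> T} => (b ord0, [ffun i => b (lift ord0 i)])).
  move=> [x b]; rewrite ffun_cons0; congr (_, _).
  by apply/ffunP => i; rewrite ffunE ffun_consS.
move=> b; apply/ffunP => i; case: (unliftP ord0 i) => [j|] ->.
  by rewrite ffun_consS ffunE.
by rewrite ffun_cons0.
Qed.

Lemma sum_ffun_cons (V : nmodType) (F : {ffun 'I_N.+1 -> T} -> V) :
  \sum_b F b = \sum_x \sum_b F (ffun_cons (x, b)).
Proof.
rewrite (reindex ffun_cons (onW_bij _ ffun_cons_bij)) /= pair_bigA /=.
by apply: eq_bigr => -[].
Qed.

End FfunCons.

Section Loops.
Variables (C : comPzRingType) (k : nat) (Omega : Type) (Lab : Type).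
Variables (X : Omega -> Lab -> 'M[C]_k) (D : (Omega -> C) -> Prop).
Hypothesis DA : subalgebra D.
Hypothesis Dtr : forall w, D (fun x => \tr (word_mx (X x) w)).

(** The sum is the product, over the cycles of s, of the traces of the words met
    along the cycle.  In the induction, slot 0 is removed: if s fixes it, it
    contributes a trace, and otherwise its word is appended to the word of the
    slot p that s maps to it, and p inherits the image of slot 0. *)
Lemma loop_contraction N (s : 'S_N) (w : 'I_N -> seq Lab) :
  D (fun x => \sum_(b : {ffun 'I_N -> 'I_k})
                \prod_i word_mx (X x) (w i) (b i) (b (s i))).
Proof.
elim: N s w => [|N IH] s w.
  apply: (subalg_eq (subalg_cst DA 1)) => x.
  rewrite (eq_bigr (fun _ => 1)) => [|b _]; last by rewrite big_ord0.
  by rewrite sumr_const card_ffun !card_ord expn0.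
pose s' := (s * tperm ord0 (s ord0))%g.
have s'0 : s' ord0 = ord0 by rewrite permM tpermR.
have [t tE] : exists t : 'S_N, forall i, s' (lift ord0 i) = lift ord0 (t i).
  have E i : exists j, s' (lift ord0 i) = lift ord0 j.
    case: (unliftP ord0 (s' (lift ord0 i))) => [j ->|e]; first by exists j.
    have : s' (lift ord0 i) == s' ord0 by rewrite s'0 e.
    by rewrite (inj_eq perm_inj) eq_sym (negbTE (neq_lift _ _)).
  have [f fE] := choice E.
  have inj : injective f.
    move=> i j e; apply: (@lift_inj N.+1 ord0); apply: (@perm_inj _ s').
    by rewrite !fE e.
  by exists (perm inj) => i; rewrite fE permE.
have sE i : s i = tperm ord0 (s ord0) (s' i) by rewrite permM tpermK.
have [s0|s0] := eqVneq (s ord0) ord0.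
  have slift i : s (lift ord0 i) = lift ord0 (t i).
    by rewrite sE s0 tperm1 perm1 tE.
  apply: subalg_eq (subalg_mul DA (Dtr (w ord0)) (IH t (fun i => w (lift ord0 i)))) _.
  move=> x; rewrite sum_ffun_cons mulr_suml; apply: eq_bigr => a _.
  rewrite mulr_sumr; apply: eq_bigr => b _.
  rewrite big_ord_recl s0 ffun_cons0; congr (_ * _).
  by apply: eq_bigr => i _; rewrite slift !ffun_consS.
pose p := (s^-1 ord0)%g.
have sp : s p = ord0 by rewrite permKV.
have [p' pE] : exists p', p = lift ord0 p'.
  case: (unliftP ord0 p) => [p' ->|e]; first by exists p'.
  by move: s0; rewrite -e sp e eqxx.
have [j' jE] : exists j', s ord0 = lift ord0 j'.
  case: (unliftP ord0 (s ord0)) => [j' ->|e]; first by exists j'.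
  by rewrite e eqxx in s0.
have tp : t p' = j'.
  by apply: (@lift_inj N.+1 ord0); rewrite -tE -pE permM sp tpermL.
have slift i : i != p' -> s (lift ord0 i) = lift ord0 (t i).
  move=> ip; rewrite sE tE tpermD // ?neq_lift // jE -tp.
  by rewrite (inj_eq lift_inj) (inj_eq perm_inj) eq_sym.
pose w' i := if i == p' then w p ++ w ord0 else w (lift ord0 i).
apply: subalg_eq (IH t w') _ => x.
rewrite sum_ffun_cons exchange_big /=; apply: eq_bigr => b _.
rewrite (bigD1 p') //= {1}/w' eqxx word_mx_cat mxE mulr_suml.
apply: eq_bigr => a _.
rewrite big_ord_recl ffun_cons0 jE ffun_consS (bigD1 p') //= -pE sp ffun_cons0.
rewrite {2}pE ffun_consS tp mulrA [_ * word_mx _ (w p) _ _]mulrC; congr (_ * _).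
by apply: eq_bigr => i ip; rewrite /w' (negbTE ip) slift // !ffun_consS.
Qed.

End Loops.

(** * Invariants of simultaneous conjugation *)

Lemma invmxM (C : comUnitRingType) k (g h : 'M[C]_k) :
  g \in unitmx -> h \in unitmx -> invmx (g *m h) = invmx h *m invmx g.
Proof.
move=> ug uh; have ugh : g *m h \in unitmx by rewrite unitmx_mul ug.
apply: (can_inj (mulKmx ugh)); rewrite mulmxV // mulmxA -(mulmxA g).
by rewrite (mulmxV uh) mulmx1 mulmxV.
Qed.

Section FirstFundamentalTheorem.
Variables (C : numClosedFieldType) (k : nat) (Omega : Type) (Lab : finType).
Variables (X : Omega -> Lab -> 'M[C]_k) (D : (Omega -> C) -> Prop).
Hypothesis DA : subalgebra D.
Hypothesis Dtr : forall w, D (fun x => \tr (word_mx (X x) w)).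
Variable N : nat.
Local Notation J := {ffun 'I_N -> 'I_k}.
Local Notation K := ({ffun 'I_N -> Lab} * (J * J))%type.

Let sumK (F : 'I_#|{: K}| -> C) :
  \sum_i F i = \sum_l \sum_a \sum_b F (enum_rank (l, (a, b))).
Proof.
rewrite (reindex _ (onW_bij _ (@enum_rank_bij _))) /=.
under [RHS]eq_bigr do rewrite pair_bigA /=.
by rewrite pair_bigA; apply: eq_bigr => -[l [a b]].
Qed.

(** The action of g by conjugation on the N-th tensor power of the matrix space,
    one copy for each family of labels.  All labels must be treated at once,
    since only their total is known to be invariant. *)
Let Gm (g : 'M[C]_k) : 'M[C]_#|{: K}| :=
  \matrix_(i, j) (((enum_val i).1 == (enum_val j).1)%:R *
     (tensor_power g (enum_val i).2.1 (enum_val j).2.1 *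
      tensor_power (invmx g) (enum_val j).2.2 (enum_val i).2.2)).

Let GmE g l a b l' a' b' : Gm g (enum_rank (l, (a, b))) (enum_rank (l', (a', b'))) =
  (l == l')%:R * (tensor_power g a a' * tensor_power (invmx g) b' b).
Proof. by rewrite mxE !enum_rankK. Qed.

Let sum_label (F : {ffun 'I_N -> Lab} -> J -> J -> C) l :
  \sum_l' \sum_a \sum_b (l == l')%:R * F l' a b = \sum_a \sum_b F l a b.
Proof.
rewrite (bigD1 l) //= [X in _ + X]big1 => [|l' /negbTE ne].
  by rewrite addr0; under eq_bigr do under eq_bigr do rewrite eqxx mul1r.
by rewrite big1 // => a _; rewrite big1 // => b _; rewrite eq_sym ne mul0r.
Qed.

Let GmM g h : g \in unitmx -> h \in unitmx -> Gm g *m Gm h = Gm (g *m h).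
Proof.
move=> ug uh; apply/matrixP => i j.
rewrite -(enum_valK i) -(enum_valK j).
case: (enum_val i) => l [a b]; case: (enum_val j) => l' [a' b'].
rewrite mxE sumK GmE.
under eq_bigr do under eq_bigr do under eq_bigr do rewrite !GmE -mulrA.
rewrite sum_label.
transitivity (\sum_a0 \sum_b0 (l == l')%:R *
    ((tensor_power g a a0 * tensor_power h a0 a') *
     (tensor_power (invmx h) b' b0 * tensor_power (invmx g) b0 b))).
  by apply: eq_bigr => a0 _; apply: eq_bigr => b0 _; ring.
under eq_bigr do rewrite -mulr_sumr -mulr_sumr.
rewrite -mulr_sumr -mulr_suml !tensor_prodM; congr (_ * (_ * _)).
by rewrite invmxM.
Qed.

Let conjT_inv (g : 'M[C]_k) : invmx (conjT g) = conjT (invmx g).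
Proof. by rewrite /conjT trmx_inv map_invmx. Qed.

Let conjT_power (g : 'M[C]_k) (a b : J) :
  (tensor_power g a b)^* = tensor_power (conjT g) b a.
Proof.
by rewrite /tensor_power /tensor_prod rmorph_prod; apply: eq_bigr => s _; rewrite !mxE.
Qed.

Let Gm_conj g : conjT (Gm g) = Gm (conjT g).
Proof.
apply/matrixP => i j.
rewrite -(enum_valK i) -(enum_valK j).
case: (enum_val i) => l [a b]; case: (enum_val j) => l' [a' b'].
rewrite mxE mxE !GmE !rmorphM /= !conjT_power conjT_inv eq_sym.
by rewrite conjC_nat.
Qed.

Let Tv (x : Omega) : 'cV[C]_#|{: K}| :=
  \col_i let r : K := enum_val i in tensor_prod (fun s => X x (r.1 s)) r.2.1 r.2.2.

Let GmT g x l a b : (Gm g *m Tv x) (enum_rank (l, (a, b))) 0 =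
  tensor_prod (fun s => g *m X x (l s) *m invmx g) a b.
Proof.
rewrite mxE sumK.
under eq_bigr do under eq_bigr do under eq_bigr do
  rewrite GmE mxE !enum_rankK -mulrA /=.
rewrite sum_label -tensor_prodM exchange_big /=.
apply: eq_bigr => b' _; rewrite -tensor_prodM mulr_suml.
apply: eq_bigr => a' _; rewrite /tensor_power; ring.
Qed.

(** A relative form of the first fundamental theorem for matrix invariants: the
    polynomial with coefficients v is constant along the orbits of the points
    X x, and possibly along no others. *)
Theorem conjugation_invariants (v : {ffun 'I_N -> Lab} -> J -> J -> C) (f : Omega -> C) :
    (forall x g, g \in unitmx ->
       \sum_l \sum_a \sum_b v l a b *
         tensor_prod (fun s => g *m X x (l s) *m invmx g) a b = f x) ->
  D f.
Proof.
move=> fE.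
pose vr : 'rV[C]_#|{: K}| :=
  \row_i v (enum_val i : K).1 (enum_val i : K).2.1 (enum_val i : K).2.2.
pose Gs M := exists2 g, g \in unitmx & M = Gm g.
have [|_ [g ug ->]|v0 v0G v0T] := @invariant_part _ _ Gs vr.
- move=> _ _ [g ug ->] [h uh ->]; exists (g *m h); last by rewrite GmM.
  by rewrite unitmx_mul ug.
- exists (conjT g); last exact: Gm_conj.
  by rewrite /conjT map_unitmx unitmx_tr.
have vT g x : g \in unitmx -> (vr *m Gm g *m Tv x) 0 0 = f x.
  move=> ug; rewrite -mulmxA mxE sumK -[RHS](fE x g ug).
  apply: eq_bigr => l _; apply: eq_bigr => a _; apply: eq_bigr => b _.
  by rewrite mxE enum_rankK GmT.
have Gm1 : vr *m Gm 1%:M = vr.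
  apply/rowP => j; rewrite mxE sumK -(enum_valK j).
  case: (enum_val j) => l [a b].
  under eq_bigr do under eq_bigr do under eq_bigr do
    rewrite GmE invmx1 !tensor_power1 mulrCA eq_sym.
  rewrite sum_label (bigD1 a) //= [X in _ + X]big1 => [|a' /negbTE ne]; last first.
    by rewrite big1 // => b' _; rewrite ne mul0r mulr0.
  rewrite (bigD1 b) //= [X in _ + X + _]big1 => [|b' /negbTE ne]; last first.
    by rewrite [b == _]eq_sym ne !mulr0.
  by rewrite !eqxx !mulr1 !addr0 !mxE !enum_rankK.
have fv0 x : f x = \sum_l \sum_a \sum_b v0 0 (enum_rank (l, (a, b))) *
    tensor_prod (fun s => X x (l s)) a b.
  rewrite -(vT 1%:M) ?unitmx1 // Gm1 -v0T => [|_ [g ug ->]].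
    rewrite mxE sumK.
    apply: eq_bigr => l _; apply: eq_bigr => a _; apply: eq_bigr => b _.
    by rewrite !mxE enum_rankK.
  apply/matrixP => i j; rewrite !ord1 vT // -(vT 1%:M) ?unitmx1 //.
  by rewrite Gm1.
apply: subalg_eq fv0; apply: (subalg_sum DA) => l.
(* For fixed labels, invariance of v0 says that Phi commutes with g^(tensor N). *)
pose Phi (b a : J) := v0 0 (enum_rank (l, (a, b))).
have PhiG g : g \in unitmx -> forall a' b',
    \sum_a \sum_b tensor_power (invmx g) b' b * Phi b a * tensor_power g a a' = Phi b' a'.
  move=> ug a' b'; rewrite /Phi.
  have /rowP /(_ (enum_rank (l, (a', b')))) := v0G _ (ex_intro2 _ _ g ug erefl).
  rewrite mxE sumK => <-.
  under [RHS]eq_bigr do under eq_bigr do under eq_bigr do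
    rewrite GmE mulrCA eq_sym.
  rewrite sum_label; apply: eq_bigr => a _; apply: eq_bigr => b _; ring.
have [g ug b a'|w Phiw] := @schur_weyl C k N Phi.
  under [RHS]eq_bigr do rewrite -(PhiG g ug) mulr_sumr.
  rewrite exchange_big /=; apply: eq_bigr => a _.
  under eq_bigr do rewrite mulr_sumr.
  rewrite exchange_big /=.
  under eq_bigr do under eq_bigr do rewrite !mulrA.
  under eq_bigr do rewrite -!mulr_suml tensor_powerM.
  rewrite (bigD1 b) //= big1 => [|b' /negbTE ne].
    by rewrite mulmxV // tensor_power1 eqxx mul1r addr0.
  by rewrite mulmxV // tensor_power1 eq_sym ne !mul0r.
have Dloops := subalg_sum DA (index_enum 'S_N) (fun s : 'S_N => subalg_scale DA (w s)
  (loop_contraction DA Dtr s (fun i => [:: l i]))).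
apply: subalg_eq Dloops _ => x /=.
under eq_bigr do under eq_bigr do rewrite -/(Phi _ _) Phiw mulr_suml.
under eq_bigr do rewrite exchange_big /=.
rewrite exchange_big /=; apply: eq_bigr => s _.
rewrite mulr_sumr; apply: eq_bigr => a _.
rewrite (bigD1 (slot_perm s a)) //= big1 => [|b /negbTE ne].
  rewrite eqxx mulr1 addr0; congr (_ * _); apply: eq_bigr => i _.
  by rewrite mulmx1 ffunE.
by rewrite ne mulr0 mul0r.
Qed.

End FirstFundamentalTheorem.

(** * Derivations and polynomials in variables indexed by a finite type *)

Lemma mpoly_gen_ind (C : comNzRingType) n (Q : {mpoly C[n]} -> Prop) :
    (forall c, Q c%:MP) -> (forall i, Q 'X_i) ->
    (forall p q, Q p -> Q q -> Q (p + q)) ->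
    (forall p q, Q p -> Q q -> Q (p * q)) ->
  forall p, Q p.
Proof.
move=> QC QX QD QM p.
have Q0 : Q 0 by rewrite -[0]mpolyC0; exact: QC.
have Q1 : Q 1 by rewrite -[1]mpolyC1; exact: QC.
rewrite [p]mpolyE; apply: (big_ind Q _ QD) => // m _.
rewrite -mul_mpolyC; apply: (QM _ _ (QC _)).
rewrite mpolyXE_id; apply: (big_ind Q _ QM) => // i _.
by elim: (m i) => [|j IH]; rewrite ?expr0 // exprS; apply: QM.
Qed.

Section Derivations.

Record derivation (P : pzRingType) (d : P -> P) : Prop := Derivation {
  der_add : forall x y, d (x + y) = d x + d y;
  der_mul : forall x y, d (x * y) = d x * y + x * d y }.

Variables (P : comPzRingType) (d : P -> P).
Hypothesis dD : derivation d.

Lemma der0 : d 0 = 0.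
Proof. by apply: (addrI (d 0)); rewrite -(der_add dD) !addr0. Qed.

Lemma der_sum I (r : seq I) (F : I -> P) : d (\sum_(i <- r) F i) = \sum_(i <- r) d (F i).
Proof.
elim: r => [|i r IH]; first by rewrite !big_nil der0.
by rewrite !big_cons (der_add dD) IH.
Qed.

Lemma der_opp x : d (- x) = - d x.
Proof. by apply/eqP; rewrite -addr_eq0 -(der_add dD) addNr der0. Qed.

Lemma der_sub x y : d (x - y) = d x - d y.
Proof. by rewrite (der_add dD) der_opp. Qed.

Lemma deriv_trace n (M : 'M[P]_n) : d (\tr M) = \tr (map_mx d M).
Proof. by rewrite der_sum; apply: eq_bigr => i _; rewrite mxE. Qed.

Lemma deriv_mulmx m n p (M : 'M[P]_(m, n)) (N : 'M_(n, p)) :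
  map_mx d (M *m N) = map_mx d M *m N + M *m map_mx d N.
Proof.
apply/matrixP => i j; rewrite !mxE der_sum -big_split /=.
by apply: eq_bigr => l _; rewrite (der_mul dD) !mxE.
Qed.

Lemma deriv_commutator m n (J : 'M[P]_(m, n)) (W : 'M_n) (I : 'M_(n, m)) (E : 'M_m) :
    map_mx d J = - (E *m J) -> map_mx d I = I *m E -> map_mx d W = 0 ->
  map_mx d (J *m W *m I) = J *m W *m I *m E - E *m (J *m W *m I).
Proof.
move=> dJ dI dW; rewrite 2!deriv_mulmx dJ dI dW mulmx0 addr0.
by rewrite addrC !mulNmx !mulmxA.
Qed.

Lemma deriv_mx1 n : map_mx d 1%:M = 0 :> 'M_n.
Proof.
have := deriv_mulmx (1%:M : 'M_n) 1%:M.
rewrite !mulmx1 mul1mx => /eqP; rewrite eq_sym -subr_eq0 addrK => /eqP.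
by [].
Qed.

Lemma deriv_power n Lab (X : Lab -> 'M[P]_n) l q :
  map_mx d (word_mx X (nseq q.+1 l)) =
  \sum_(r < q.+1) word_mx X (nseq r l) *m map_mx d (X l) *m word_mx X (nseq (q - r) l).
Proof.
elim: q => [|q IH].
  by rewrite big_ord1 /= deriv_mulmx deriv_mx1 mulmx0 addr0 mul1mx.
rewrite [LHS]/= -/(word_mx X (nseq q.+1 l)) deriv_mulmx IH [in RHS]big_ord_recl.
rewrite mulmx_sumr /= mul1mx; congr (_ + _).
by apply: eq_bigr => r _; rewrite /= /bump /= !mulmxA subSS.
Qed.

(** Cyclicity of the trace makes the terms of the Leibniz formula equal. *)
Lemma deriv_trace_power n Lab (X : Lab -> 'M[P]_n) l q :
  d (\tr (word_mx X (nseq q.+1 l))) =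
  \tr (word_mx X (nseq q l) *m map_mx d (X l)) *+ q.+1.
Proof.
rewrite deriv_trace deriv_power raddf_sum /= -[q.+1 in RHS]card_ord -sumr_const.
apply: eq_bigr => r _.
rewrite -mulmxA mxtrace_mulC -mulmxA -word_mx_cat -nseqD subnK; last by rewrite -ltnS.
by rewrite mxtrace_mulC.
Qed.

End Derivations.

Section Variables.
Variables (C : comNzRingType) (J : finType).

Definition varOn (v : J) : polyOn C J := 'X_(enum_rank v).

Lemma evalOn_var v x : evalOn (varOn v) x = x v.
Proof. by rewrite /evalOn mevalXU enum_rankK. Qed.

Definition mx_evalOn m n (M : 'M[polyOn C J]_(m, n)) (x : J -> C) : 'M[C]_(m, n) :=
  map_mx (fun F => evalOn F x) M.

Lemma mx_evalOnM m n p (M : 'M_(m, n)) (L : 'M_(n, p)) x :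
  mx_evalOn (M *m L) x = mx_evalOn M x *m mx_evalOn L x.
Proof.
apply/matrixP => i j; rewrite !mxE /evalOn rmorph_sum.
by apply: eq_bigr => l _; rewrite /= mevalM !mxE.
Qed.

Lemma mx_evalOn_word n Lab (X : Lab -> 'M_n) w x :
  mx_evalOn (word_mx X w) x = word_mx (fun l => mx_evalOn (X l) x) w.
Proof.
elim: w => [|l w IH] /=; last by rewrite mx_evalOnM IH.
by apply/matrixP => i j; rewrite !mxE /evalOn; case: eqP; rewrite ?meval1 ?meval0.
Qed.

Lemma evalOn_tr n (M : 'M[polyOn C J]_n) x : evalOn (\tr M) x = \tr (mx_evalOn M x).
Proof. by rewrite /evalOn rmorph_sum; apply: eq_bigr => i _; rewrite mxE. Qed.

Lemma derivOn_var v w : derivOn v (varOn w) = (v == w)%:R.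
Proof.
rewrite /derivOn /varOn mderivX mnm1E (inj_eq enum_rank_inj) eq_sym.
case: eqP => [->|_]; last by rewrite scale0r.
rewrite scale1r; set u := U_(_)%MM.
have -> : (u - u = 0)%MM by apply/mnmP => i; rewrite mnmBE subnn mnm0E.
by rewrite mpolyX0.
Qed.

Lemma derivOn_derivation (v : J) : derivation (@derivOn C J v).
Proof. by split=> x y; rewrite /derivOn ?mderivD ?mderivM. Qed.

End Variables.

(** Both sides are derivations in F along the morphism phi; it is used with
    values in {poly C} to differentiate along lines and with values in polynomials to
    differentiate after a renaming of the variables. *)
Lemma chain_rule (C : comNzRingType) (J : finType) (P : comNzRingType)
    (f : {rmorphism C -> P}) (h : J -> P) (d : P -> P) (F : polyOn C J) :
    derivation d -> (forall c, d (f c) = 0) ->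
  let phi := mmap f (fun l => h (enum_val l)) in
  d (phi F) = \sum_v phi (derivOn v F) * d (h v).
Proof.
move=> dD df phi.
elim/mpoly_gen_ind: F => [c|i|p q Hp Hq|p q Hp Hq].
- rewrite /phi mmapC df big1 // => v _.
  by rewrite /derivOn mderivC mmap0 mul0r.
- rewrite {1}/phi mmapX mmap1U -(enum_valK i) (bigD1 (enum_val i)) //=.
  rewrite -/(varOn C (enum_val i)) derivOn_var eqxx big1 => [|v /negbTE ne].
    by rewrite /phi rmorph1 mul1r addr0 enum_rankK.
  by rewrite derivOn_var ne /phi rmorph0 mul0r.
- rewrite /phi mmapD (der_add dD) Hp Hq -big_split; apply: eq_bigr => v _.
  by rewrite (der_add (derivOn_derivation _ _)) mmapD mulrDl.
- rewrite /phi rmorphM (der_mul dD) Hp Hq mulr_suml mulr_sumr -big_split.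
  apply: eq_bigr => v _ /=.
  rewrite (der_mul (derivOn_derivation _ _)) rmorphD !rmorphM /=; ring.
Qed.

Section Rename.
Variables (C : comNzRingType) (J1 J2 : finType) (e : J1 -> J2).

Definition renameOn (F : polyOn C J1) : polyOn C J2 :=
  mmap (@mpolyC _ C) (fun l => varOn C (e (enum_val l))) F.

Lemma evalOn_rename F x : evalOn (renameOn F) x = evalOn F (fun v => x (e v)).
Proof.
rewrite /evalOn /renameOn; elim/mpoly_gen_ind: F => [c|i|p q Hp Hq|p q Hp Hq].
- by rewrite mmapC !mevalC.
- by rewrite mmapX mmap1U /varOn !mevalXU enum_rankK.
- by rewrite mmapD !mevalD Hp Hq.
- by rewrite rmorphM /= !mevalM Hp Hq.
Qed.

Lemma derivOn_rename v F : (forall w, e w != v) -> derivOn v (renameOn F) = 0.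
Proof.
move=> ev; rewrite /renameOn.
rewrite (@chain_rule _ _ _ (@mpolyC _ C) (fun w => varOn C (e w))) ?big1 //.
- by move=> w _; rewrite derivOn_var eq_sym (negbTE (ev w)) mulr0.
- exact: derivOn_derivation.
- by move=> c; rewrite /derivOn mderivC.
Qed.

End Rename.

(** * The bracket of invariant polynomials is invariant *)

Lemma poly_nat_inj (C : numDomainType) (p q : {poly C}) :
  (forall n : nat, p.[n%:R] = q.[n%:R]) -> p = q.
Proof.
move=> pq; apply/eqP; rewrite -subr_eq0; apply/eqP/poly_nat_roots_eq0 => n.
by rewrite hornerD hornerN pq subrr.
Qed.

Lemma mxtrace_mulE (C : comNzRingType) m n (M : 'M[C]_(m, n)) (L : 'M[C]_(n, m)) :
  \tr (M *m L) = \sum_a \sum_b M b a * L a b.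
Proof.
rewrite mxtrace_mulC; apply: eq_bigr => a _; rewrite mxE.
by apply: eq_bigr => b _; rewrite mulrC.
Qed.

Lemma mxtrace_delta (C : comNzRingType) m n (L : 'M[C]_(m, n)) i j :
  \tr (L *m delta_mx j i) = L i j.
Proof.
rewrite /mxtrace (bigD1 i) //= mxE (bigD1 j) //= !mxE !eqxx mulr1.
rewrite big1 => [|j' /negbTE ne]; last by rewrite mxE ne mulr0.
rewrite big1 ?addr0 // => i' /negbTE ne; rewrite mxE big1 // => j' _.
by rewrite mxE ne andbF mulr0.
Qed.

Lemma mxtrace_inj (C : comNzRingType) m n (M M' : 'M[C]_(m, n)) :
  (forall U, \tr (M *m U) = \tr (M' *m U)) -> M = M'.
Proof.
by move=> MU; apply/matrixP => i j; rewrite -!mxtrace_delta MU.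
Qed.

Section QuadPolynomials.
Variables (C : numFieldType) (k : nat).
Local Notation pol := (polyOn C (quad_var k)).
Implicit Types (F G : pol) (z u : quad C k).

Lemma quad_evalD F G z : quad_eval (F + G) z = quad_eval F z + quad_eval G z.
Proof. exact: mevalD. Qed.
Lemma quad_evalB F G z : quad_eval (F - G) z = quad_eval F z - quad_eval G z.
Proof. exact: mevalB. Qed.
Lemma quad_evalN F z : quad_eval (- F) z = - quad_eval F z.
Proof. exact: mevalN. Qed.
Lemma quad_evalM F G z : quad_eval (F * G) z = quad_eval F z * quad_eval G z.
Proof. exact: mevalM. Qed.
Lemma quad_eval0 z : quad_eval 0 z = 0.
Proof. exact: meval0. Qed.
Lemma quad_evalMn F n z : quad_eval (F *+ n) z = quad_eval F z *+ n.
Proof. exact: mevalMn. Qed.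
Lemma quad_eval_sum I (r : seq I) (E : I -> pol) z :
  quad_eval (\sum_(i <- r) E i) z = \sum_(i <- r) quad_eval (E i) z.
Proof. by rewrite /quad_eval /evalOn rmorph_sum. Qed.
Lemma quad_eval_var v z : quad_eval (varOn C v) z = quad_coord z v.
Proof. exact: evalOn_var. Qed.

Definition mx_eval m n (M : 'M[pol]_(m, n)) z : 'M[C]_(m, n) := mx_evalOn M (quad_coord z).

Lemma mx_evalM m n p (M : 'M[pol]_(m, n)) (M' : 'M_(n, p)) z :
  mx_eval (M *m M') z = mx_eval M z *m mx_eval M' z.
Proof. exact: mx_evalOnM. Qed.

Lemma quad_eval_tr n (M : 'M[pol]_n) z : quad_eval (\tr M) z = \tr (mx_eval M z).
Proof. exact: evalOn_tr. Qed.

Lemma quad_eval_mx m n (M : 'M[pol]_(m, n)) z i j : quad_eval (M i j) z = mx_eval M z i j.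
Proof. by rewrite [RHS]mxE. Qed.

Lemma sum_quad_var (V : nmodType) (E : quad_var k -> V) :
  \sum_v E v = \sum_a \sum_b E (varA a b) + \sum_a \sum_b E (varB a b) +
               \sum_a \sum_c E (vari a c) + \sum_c \sum_a E (varj c a).
Proof.
rewrite !big_sumType /= !pair_bigA /=.
by congr (_ + _ + _ + _); apply: eq_bigr => -[].
Qed.

(** Indices are transposed so that the differential is a sum of traces, which
    makes the behaviour of the gradients under the action of GL(k) visible. *)
Definition gradA F z := \matrix_(b, a) quad_eval (derivOn (varA a b) F) z.
Definition gradB F z := \matrix_(b, a) quad_eval (derivOn (varB a b) F) z.
Definition gradi F z := \matrix_(c, a) quad_eval (derivOn (vari a c) F) z.
Definition gradj F z := \matrix_(a, c) quad_eval (derivOn (varj c a) F) z.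

Definition differential F z u :=
  \tr (gradA F z *m qA u) + \tr (gradB F z *m qB u) +
  \tr (gradi F z *m qi u) + \tr (gradj F z *m qj u).

Lemma bracket_eval F G z : quad_eval (bracket F G) z =
  \tr (gradA F z *m gradB G z) - \tr (gradB F z *m gradA G z) +
  \tr (gradj F z *m gradi G z) - \tr (gradi F z *m gradj G z).
Proof.
rewrite quad_evalD !quad_eval_sum -[RHS]addrA.
rewrite (mxtrace_mulC (gradB F z)) (mxtrace_mulC (gradi F z)) !mxtrace_mulE -!sumrB.
congr (_ + _); apply: eq_bigr => a _; rewrite quad_eval_sum -sumrB;
  apply: eq_bigr => b _; rewrite quad_evalB !quad_evalM !mxE;
  by congr (_ - _); rewrite mulrC.
Qed.

Lemma differentialE F z u :
  differential F z u = \sum_v quad_eval (derivOn v F) z * quad_coord u v.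
Proof.
by rewrite sum_quad_var /differential !mxtrace_mulE; congr (_ + _ + _ + _);
  apply: eq_bigr => a _; apply: eq_bigr => b _; rewrite !mxE.
Qed.

Definition quad_line z u (t : C) : quad C k :=
  Quad (qA z + t *: qA u) (qB z + t *: qB u) (qi z + t *: qi u) (qj z + t *: qj u).

Lemma quad_line_act g z u t :
  quad_act g (quad_line z u t) = quad_line (quad_act g z) (quad_act g u) t.
Proof.
by rewrite /quad_act /quad_line /=; congr Quad;
  rewrite ?mulmxDr ?mulmxDl -?scalemxAr -?scalemxAl ?mulmxDr -?scalemxAr.
Qed.

Definition line_poly F z u : {poly C} :=
  mmap (@polyC C)
    (fun l => (quad_coord z (enum_val l))%:P + quad_coord u (enum_val l) *: 'X) F.

Lemma line_polyE F z u t : (line_poly F z u).[t] = quad_eval F (quad_line z u t).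
Proof.
have cE v : quad_coord (quad_line z u t) v = quad_coord z v + t * quad_coord u v.
  by case: v => [[[[a b]|[a b]]|[a c]]|[c a]]; rewrite /= !mxE.
rewrite /line_poly /quad_eval /evalOn.
elim/mpoly_gen_ind: F => [c|i|p q Hp Hq|p q Hp Hq].
- by rewrite mmapC mevalC hornerC.
- by rewrite mmapX mmap1U mevalXU cE hornerD hornerC hornerZ hornerX mulrC.
- by rewrite mmapD hornerD Hp Hq mevalD.
- by rewrite rmorphM hornerM /= Hp Hq mevalM.
Qed.

Lemma line_poly_deriv F z u : (line_poly F z u)^`().[0] = differential F z u.
Proof.
rewrite differentialE /line_poly.
rewrite (@chain_rule _ _ _ (@polyC C)
  (fun v => (quad_coord z v)%:P + quad_coord u v *: 'X) (@deriv C)).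
- rewrite -horner_evalE rmorph_sum; apply: eq_bigr => v _.
  rewrite /= horner_evalE hornerM derivD derivC derivZ derivX add0r hornerZ hornerC mulr1.
  congr (_ * _); rewrite -/(line_poly _ _ _) line_polyE; congr quad_eval.
  by case: z => *; rewrite /quad_line /= !scale0r !addr0.
- by split=> p q; rewrite ?derivD ?derivM.
- by move=> c; rewrite derivC.
Qed.

(** Two polynomials in t, the restrictions of F to a line and to its image,
    coincide; so do their derivatives at 0. *)
Lemma differential_act F g z u : quad_invariant F -> g \in unitmx ->
  differential F (quad_act g z) (quad_act g u) = differential F z u.
Proof.
move=> Finv ug; rewrite -!line_poly_deriv; congr (_^`().[_]).
by apply: poly_nat_inj => n; rewrite !line_polyE -quad_line_act Finv.
Qed.

Section Act.
Variables (F : pol) (g : 'M[C]_k) (z : quad C k).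
Hypotheses (Finv : quad_invariant F) (ug : g \in unitmx).

Lemma gradA_act : gradA F (quad_act g z) = g *m gradA F z *m invmx g.
Proof.
have E : invmx g *m gradA F (quad_act g z) *m g = gradA F z.
  apply: mxtrace_inj => U.
  have := differential_act z (Quad U 0 0 0) Finv ug.
  rewrite /differential /= !(mulmx0, mul0mx, mxtrace0, addr0) => <-.
  by rewrite -!mulmxA mxtrace_mulC !mulmxA.
by rewrite -E !mulmxA mulmxV // mul1mx mulmxK.
Qed.

Lemma gradB_act : gradB F (quad_act g z) = g *m gradB F z *m invmx g.
Proof.
have E : invmx g *m gradB F (quad_act g z) *m g = gradB F z.
  apply: mxtrace_inj => U.
  have := differential_act z (Quad 0 U 0 0) Finv ug.
  rewrite /differential /= !(mulmx0, mul0mx, mxtrace0, addr0, add0r) => <-.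
  by rewrite -!mulmxA mxtrace_mulC !mulmxA.
by rewrite -E !mulmxA mulmxV // mul1mx mulmxK.
Qed.

Lemma gradi_act : gradi F (quad_act g z) = gradi F z *m invmx g.
Proof.
have E : gradi F (quad_act g z) *m g = gradi F z.
  apply: mxtrace_inj => U.
  have := differential_act z (Quad 0 0 U 0) Finv ug.
  rewrite /differential /= !(mulmx0, mul0mx, mxtrace0, addr0, add0r) => <-.
  by rewrite mulmxA.
by rewrite -E mulmxK.
Qed.

Lemma gradj_act : gradj F (quad_act g z) = g *m gradj F z.
Proof.
have E : invmx g *m gradj F (quad_act g z) = gradj F z.
  apply: mxtrace_inj => U.
  have := differential_act z (Quad 0 0 0 U) Finv ug.
  rewrite /differential /= !(mulmx0, mul0mx, mxtrace0, addr0, add0r) => <-.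
  by rewrite -mulmxA mxtrace_mulC mulmxA.
by rewrite -E mulKVmx.
Qed.

End Act.

(** By invariance of the differential, the gradients transform contragrediently,
    and g cancels in each trace of bracket_eval. *)
Lemma bracket_invariant F G :
  quad_invariant F -> quad_invariant G -> quad_invariant (bracket F G).
Proof.
move=> Fi Gi g z ug.
have conj_tr (M N : 'M[C]_k) :
    \tr ((g *m M *m invmx g) *m (g *m N *m invmx g)) = \tr (M *m N).
  by rewrite mxtrace_mulC !mulmxA mulmxKV // mxtrace_mulC !mulmxA mulVmx //
    mul1mx mxtrace_mulC.
rewrite !bracket_eval !gradA_act ?gradB_act ?gradi_act ?gradj_act // !conj_tr.
congr (_ + _ - _).
  by rewrite mxtrace_mulC !mulmxA mulmxKV // mxtrace_mulC.
by rewrite mulmxA mulmxKV.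
Qed.

End QuadPolynomials.

(** * Hamiltonian derivations *)

Section DerivationClosure.
Variable P : comPzRingType.

Lemma derivation_add (d e : P -> P) :
  derivation d -> derivation e -> derivation (fun x => d x + e x).
Proof.
by move=> dD eD; split=> x y;
  rewrite ?(der_add dD) ?(der_add eD) ?(der_mul dD) ?(der_mul eD); ring.
Qed.

Lemma derivation_scale c (d : P -> P) : derivation d -> derivation (fun x => c * d x).
Proof. by move=> dD; split=> x y; rewrite ?(der_add dD) ?(der_mul dD); ring. Qed.

Lemma derivation_opp (d : P -> P) : derivation d -> derivation (fun x => - d x).
Proof. by move=> dD; split=> x y; rewrite ?(der_add dD) ?(der_mul dD); ring. Qed.

Lemma derivation_sum I (r : seq I) (d : I -> P -> P) :
  (forall i, derivation (d i)) -> derivation (fun x => \sum_(i <- r) d i x).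
Proof.
move=> dD; split=> x y.
  by rewrite -big_split; apply: eq_bigr => i _; rewrite (der_add (dD i)).
rewrite mulr_suml mulr_sumr -big_split; apply: eq_bigr => i _.
by rewrite (der_mul (dD i)).
Qed.

End DerivationClosure.

Section MatrixFacts.
Variable P : comNzRingType.

Lemma mulmx_natr m n p (M : 'M[P]_(m, n)) (L : 'M_(n, p)) q : M *m (L *+ q) = M *m L *+ q.
Proof. by rewrite -!scaler_nat scalemxAr. Qed.

Lemma mulmx_natl m n p (M : 'M[P]_(m, n)) (L : 'M_(n, p)) q : (M *+ q) *m L = M *m L *+ q.
Proof. by rewrite -!scaler_nat scalemxAl. Qed.

Lemma mulmx_deltaE m n p (M : 'M[P]_(m, n)) i (j : 'I_p) x y :
  (M *m delta_mx i j) x y = M x i * (y == j)%:R.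
Proof.
rewrite mxE (bigD1 i) //= big1 ?addr0 => [|l /negbTE ne]; first by rewrite mxE eqxx.
by rewrite mxE ne mulr0.
Qed.

Lemma delta_mulmxE m n p (M : 'M[P]_(n, p)) (i : 'I_m) j x y :
  (delta_mx i j *m M) x y = (x == i)%:R * M j y.
Proof.
rewrite mxE (bigD1 j) //= big1 ?addr0 => [|l /negbTE ne]; first by rewrite mxE eqxx andbT.
by rewrite mxE ne andbF mul0r.
Qed.

End MatrixFacts.

Section Hamiltonians.
Variables (C : numFieldType) (k : nat).
Local Notation pol := (polyOn C (quad_var k)).
Local Notation X := (@varOn C (quad_var k)).
Implicit Types (F G : pol) (z u : quad C k).

Lemma bracket_derivation F : derivation (bracket F).
Proof.
apply: derivation_add; apply: derivation_sum => a; apply: derivation_sum => b;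
  apply: derivation_add; first [apply: derivation_opp|idtac]; apply: derivation_scale;
  exact: derivOn_derivation.
Qed.

Lemma sum_pick m n (E : 'I_m -> 'I_n -> pol) a b :
  \sum_a' \sum_b' E a' b' * ((a' == a) && (b' == b))%:R = E a b.
Proof.
rewrite (bigD1 a) //= (bigD1 b) //= !eqxx mulr1.
rewrite big1 => [|b' /negbTE ne]; last by rewrite ne mulr0.
rewrite big1 ?addr0 // => a' /negbTE ne; rewrite big1 // => b' _.
by rewrite ne mulr0.
Qed.

Lemma bracket_varB F a b : bracket F (X (varB a b)) = derivOn (varA b a) F.
Proof.
rewrite /bracket [X in _ + X]big1 ?addr0 => [|c _]; last first.
  by rewrite big1 // => a' _; rewrite !derivOn_var !mulr0 subrr.
rewrite -(sum_pick (fun b a => derivOn (varA b a) F)).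
apply: eq_bigr => b' _; apply: eq_bigr => a' _.
by rewrite !derivOn_var mulr0 subr0 andbC.
Qed.

Lemma bracket_vari F a c : bracket F (X (vari a c)) = derivOn (varj c a) F.
Proof.
rewrite /bracket [X in X + _]big1 ?add0r => [|b _]; last first.
  by rewrite big1 // => a' _; rewrite !derivOn_var !mulr0 subrr.
rewrite -(sum_pick (fun c a => derivOn (varj c a) F)).
apply: eq_bigr => c' _; apply: eq_bigr => a' _.
by rewrite !derivOn_var mulr0 subr0 andbC.
Qed.

Lemma bracket_varj F c a : bracket F (X (varj c a)) = - derivOn (vari a c) F.
Proof.
rewrite /bracket [X in X + _]big1 ?add0r => [|b _]; last first.
  by rewrite big1 // => a' _; rewrite !derivOn_var !mulr0 subrr.
rewrite -(sum_pick (fun c a => - derivOn (vari a c) F)).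
apply: eq_bigr => c' _; apply: eq_bigr => a' _.
by rewrite !derivOn_var mulr0 sub0r mulNr.
Qed.

Definition genA : 'M[pol]_k := \matrix_(a, b) X (varA a b).
Definition genB : 'M[pol]_k := \matrix_(a, b) X (varB a b).
Definition geni : 'M[pol]_(k, 2) := \matrix_(a, c) X (vari a c).
Definition genj : 'M[pol]_(2, k) := \matrix_(c, a) X (varj c a).
Definition genAB (l : bool) := if l then genB else genA.
Definition quadAB z (l : bool) := if l then qB z else qA z.

Lemma mx_eval_genA z : mx_eval genA z = qA z.
Proof. by apply/matrixP => a b; rewrite !mxE [LHS]quad_eval_var. Qed.
Lemma mx_eval_genB z : mx_eval genB z = qB z.
Proof. by apply/matrixP => a b; rewrite !mxE [LHS]quad_eval_var. Qed.
Lemma mx_eval_geni z : mx_eval geni z = qi z.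
Proof. by apply/matrixP => a b; rewrite !mxE [LHS]quad_eval_var. Qed.
Lemma mx_eval_genj z : mx_eval genj z = qj z.
Proof. by apply/matrixP => a b; rewrite !mxE [LHS]quad_eval_var. Qed.

Lemma mx_eval_word w z : mx_eval (word_mx genAB w) z = word_mx (quadAB z) w.
Proof.
rewrite [LHS]mx_evalOn_word; congr word_mx; apply/funext => -[].
  exact: mx_eval_genB.
exact: mx_eval_genA.
Qed.

Lemma deriv_genA v : map_mx (derivOn v) genA =
  if v is inl (inl (inl (a, b))) then delta_mx a b else 0.
Proof.
apply/matrixP => a b; rewrite !mxE derivOn_var.
by case: v => [[[[a' b']|[a' b']]|[a' c']]|[c' a']];
  rewrite !mxE // [a == _]eq_sym [b == _]eq_sym.
Qed.
Lemma deriv_geni v : map_mx (derivOn v) geni =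
  if v is inl (inr (a, c)) then delta_mx a c else 0.
Proof.
apply/matrixP => a b; rewrite !mxE derivOn_var.
by case: v => [[[[a' b']|[a' b']]|[a' c']]|[c' a']];
  rewrite !mxE // [a == _]eq_sym [b == _]eq_sym.
Qed.
Lemma deriv_genj v : map_mx (derivOn v) genj =
  if v is inr (c, a) then delta_mx c a else 0.
Proof.
apply/matrixP => a b; rewrite !mxE derivOn_var.
by case: v => [[[[a' b']|[a' b']]|[a' c']]|[c' a']];
  rewrite !mxE // [a == _]eq_sym [b == _]eq_sym.
Qed.

Definition trA p : pol := \tr (word_mx genAB (nseq p false)).

Lemma derivOn_trA v p : derivOn v (trA p.+1) =
  if v is inl (inl (inl (a, b))) then word_mx genAB (nseq p false) b a *+ p.+1 else 0.
Proof.
rewrite /trA (deriv_trace_power (derivOn_derivation C v)) /= deriv_genA.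
case: v => [[[[a b]|?]|?]|?]; rewrite ?mxtrace_delta //;
by rewrite mulmx0 mxtrace0 mul0rn.
Qed.

Lemma trA_genB p : map_mx (bracket (trA p.+1)) genB = word_mx genAB (nseq p false) *+ p.+1.
Proof.
apply/matrixP => b a; rewrite !mxE bracket_varB derivOn_trA /=.
by rewrite mulmxnE.
Qed.
Lemma trA_geni p : map_mx (bracket (trA p.+1)) geni = 0.
Proof. by apply/matrixP => a c; rewrite !mxE bracket_vari derivOn_trA. Qed.
Lemma trA_genj p : map_mx (bracket (trA p.+1)) genj = 0.
Proof. by apply/matrixP => a c; rewrite !mxE bracket_varj derivOn_trA oppr0. Qed.

Lemma bracket_trA_trB p q :
  bracket (trA p.+1) (\tr (word_mx genAB (nseq q.+1 true))) =
  \tr (word_mx genAB (nseq q true ++ nseq p false)) *+ p.+1 *+ q.+1.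
Proof.
rewrite (deriv_trace_power (bracket_derivation _)) trA_genB.
by rewrite word_mx_cat mulmx_natr raddfMn.
Qed.

(** The derivation sends B to (p+1) A^p and kills A, i and j. *)
Lemma bracket_trA_jBi p q c d :
  bracket (trA p.+1) ((genj *m word_mx genAB (nseq q.+1 true) *m geni) c d) =
  (\sum_(r < q.+1) (genj *m word_mx genAB (nseq r true ++ nseq p false ++ nseq (q - r) true)
                     *m geni) c d) *+ p.+1.
Proof.
have bD := bracket_derivation (trA p.+1).
transitivity ((map_mx (bracket (trA p.+1))
  (genj *m word_mx genAB (nseq q.+1 true) *m geni)) c d).
  by rewrite [RHS]mxE.
rewrite (deriv_mulmx bD) (deriv_mulmx bD) trA_geni trA_genj mul0mx add0r mulmx0 addr0.
rewrite (deriv_power bD) trA_genB.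
rewrite mulmx_sumr mulmx_suml summxE -sumrMnl; apply: eq_bigr => r _.
by rewrite !word_mx_cat !(mulmx_natr, mulmx_natl) mulmxnE !mulmxA.
Qed.

Definition j1i0 : pol := (genj *m geni) 1 0.

Lemma derivOn_j1i0 v : derivOn v j1i0 =
  (map_mx (derivOn v) genj *m geni) 1 0 + (genj *m map_mx (derivOn v) geni) 1 0.
Proof.
transitivity ((map_mx (derivOn v) (genj *m geni)) 1 0); first by rewrite [RHS]mxE.
by rewrite (deriv_mulmx (derivOn_derivation C v)) mxE.
Qed.

Lemma j1i0_genB : map_mx (bracket j1i0) genB = 0.
Proof.
apply/matrixP => a b; rewrite !mxE bracket_varB derivOn_j1i0 deriv_genj deriv_geni /=.
by rewrite mul0mx mulmx0 !mxE addr0.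
Qed.

Lemma j1i0_geni : map_mx (bracket j1i0) geni = geni *m delta_mx 0 1.
Proof.
apply/matrixP => a c; rewrite mxE [geni a c]mxE bracket_vari derivOn_j1i0.
rewrite deriv_genj deriv_geni /= mulmx0 [X in _ + X]mxE addr0.
by rewrite delta_mulmxE mulmx_deltaE mulrC eq_sym.
Qed.

Lemma j1i0_genj : map_mx (bracket j1i0) genj = - (delta_mx 0 1 *m genj).
Proof.
apply/matrixP => c a; rewrite mxE [genj c a]mxE bracket_varj derivOn_j1i0.
rewrite deriv_genj deriv_geni /= mul0mx [X in X + _]mxE add0r.
by rewrite [RHS]mxE delta_mulmxE mulmx_deltaE mulrC eq_sym.
Qed.

(** The function j_1 i_0 generates a one-parameter subgroup of the group GL(2)
    that acts on the framing: its bracket acts on the 2x2 matrix j B^q i as the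
    commutator with an elementary matrix. *)
Lemma bracket_j1i0_jBi q :
  map_mx (bracket j1i0) (genj *m word_mx genAB (nseq q true) *m geni) =
  (genj *m word_mx genAB (nseq q true) *m geni) *m delta_mx 0 1
  - delta_mx 0 1 *m (genj *m word_mx genAB (nseq q true) *m geni).
Proof.
apply: (deriv_commutator (bracket_derivation j1i0)).
- exact: j1i0_genj.
- exact: j1i0_geni.
case: q => [|q]; first exact: (deriv_mx1 (bracket_derivation j1i0)).
rewrite (deriv_power (bracket_derivation j1i0)) big1 // => r _.
by rewrite j1i0_genB mulmx0 mul0mx.
Qed.

End Hamiltonians.

(** * Words generated by the Poisson bracket *)

Section Generators.
Variables (C : numFieldType) (k : nat).

Definition genM : 'M[polyOn C (qrep_var k)]_k :=
  \matrix_(a, b) varOn C (inl (inl (a, b)) : qrep_var k).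
Definition genv : 'cV[polyOn C (qrep_var k)]_k :=
  \col_a varOn C (inl (inr a) : qrep_var k).
Definition genw : 'rV[polyOn C (qrep_var k)]_k :=
  \row_a varOn C (inr a : qrep_var k).

Lemma mx_eval_genM (r : qrep C k) : mx_evalOn genM (qrep_coord r) = rM r.
Proof. by apply/matrixP => a b; rewrite !mxE evalOn_var. Qed.
Lemma mx_eval_genv (r : qrep C k) : mx_evalOn genv (qrep_coord r) = rv r.
Proof. by apply/matrixP => a b; rewrite !mxE evalOn_var ord1. Qed.
Lemma mx_eval_genw (r : qrep C k) : mx_evalOn genw (qrep_coord r) = rw r.
Proof. by apply/matrixP => a b; rewrite !mxE evalOn_var ord1. Qed.

Definition trM p := \tr (word_mx (fun _ : unit => genM) (nseq p tt)).
Definition wMv p := (genw *m word_mx (fun _ : unit => genM) (nseq p tt) *m genv) 0 0.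

Lemma trM_eval p (r : qrep C k) :
  qrep_eval (trM p) r = \tr (word_mx (fun _ : unit => rM r) (nseq p tt)).
Proof.
rewrite /qrep_eval /trM evalOn_tr mx_evalOn_word; congr (\tr (word_mx _ _)).
by apply/funext => _; rewrite mx_eval_genM.
Qed.

Lemma wMv_eval p (r : qrep C k) :
  qrep_eval (wMv p) r = (rw r *m word_mx (fun _ : unit => rM r) (nseq p tt) *m rv r) 0 0.
Proof.
transitivity (mx_evalOn (genw *m word_mx (fun _ : unit => genM) (nseq p tt) *m genv)
  (qrep_coord r) 0 0); first by rewrite [RHS]mxE.
rewrite !mx_evalOnM mx_eval_genv mx_eval_genw mx_evalOn_word.
by under [X in word_mx X]funext do rewrite mx_eval_genM.
Qed.

Lemma trM_invariant p : qrep_invariant (trM p).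
Proof.
move=> g r ug; rewrite !trM_eval /= word_mx_conj //.
by rewrite mxtrace_mulC mulmxA mulVmx // mul1mx.
Qed.

Lemma wMv_invariant p : qrep_invariant (wMv p).
Proof.
move=> g r ug; rewrite !wMv_eval /= word_mx_conj //.
by rewrite !mulmxA mulmxKV // -(mulmxA _ (invmx g) g) mulVmx // mulmx1.
Qed.

Lemma word_quad_act g (z : quad C k) w : g \in unitmx ->
  word_mx (quadAB (quad_act g z)) w = g *m word_mx (quadAB z) w *m invmx g.
Proof.
move=> ug; rewrite -word_mx_conj //; congr word_mx.
by apply/funext => -[].
Qed.

Lemma tr_word_invariant w : quad_invariant (\tr (word_mx (genAB C k) w)).
Proof.
move=> g z ug; rewrite !quad_eval_tr !mx_eval_word word_quad_act //.
by rewrite mxtrace_mulC mulmxA mulVmx // mul1mx.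
Qed.

Lemma jwi_eval w z c d :
  quad_eval ((genj C k *m word_mx (genAB C k) w *m geni C k) c d) z =
  (qj z *m word_mx (quadAB z) w *m qi z) c d.
Proof.
by rewrite quad_eval_mx !mx_evalM mx_eval_word mx_eval_genj mx_eval_geni.
Qed.

Lemma jwi_invariant w c d :
  quad_invariant ((genj C k *m word_mx (genAB C k) w *m geni C k) c d).
Proof.
move=> g z ug; rewrite !jwi_eval word_quad_act //= !mulmxA mulmxKV //.
by rewrite -(mulmxA _ (invmx g) g) mulVmx // mulmx1.
Qed.

End Generators.

Section PoissonGeneration.
Variables (C : numFieldType) (k : nat) (tau : C).
Local Notation level := (level k tau).
Variable S : (level -> C) -> Prop.
Hypothesis S_poisson : poisson_subalgN S.
Hypothesis S_invQ : forall f, invQ f -> S f.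
Hypothesis S_invQop : forall f, invQop f -> S f.

Let SA : subalgebra S.
Proof. by case: S_poisson => -[_ Sc Sa Sm] _; split. Qed.

Let S_eq f g : S g -> f =1 g -> S f := @subalg_eq _ _ S f g.

(** Brackets are defined on invariant polynomials, so the elements of S that enter
    a bracket are handled through polynomials. *)
Definition liftable F := quad_invariant F /\ S (restr F).

Lemma liftable_bracket F G : liftable F -> liftable G -> liftable (bracket F G).
Proof.
move=> [Fi SF] [Gi SG]; split; first exact: bracket_invariant.
by apply: (S_poisson.2 _ _ _ SF SG); exists F, G.
Qed.

Definition jwi c d w (x : level) : C :=
  (qj (sval x) *m word_mx (quadAB (sval x)) w *m qi (sval x)) c d.
Definition trw w (x : level) : C := \tr (word_mx (quadAB (sval x)) w).

Lemma momentE (x : level) : qA (sval x) *m qB (sval x) =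
  qB (sval x) *m qA (sval x) + qi (sval x) *m qj (sval x) + tau%:M.
Proof.
case: x => z /= <-; rewrite /mu.
by apply/matrixP => a b; rewrite !mxE; ring.
Qed.

(** The moment equation AB = BA + ij + tau inside a word. *)
Lemma word_swap u v (x : level) :
  let W := word_mx (quadAB (sval x)) in
  W (u ++ false :: true :: v) = W (u ++ true :: false :: v) +
    W u *m qi (sval x) *m (qj (sval x) *m W v) + tau *: W (u ++ v).
Proof.
rewrite /= !word_mx_cat /= !mulmxA -(mulmxA _ (qA _)) momentE.
by rewrite !(mulmxDr, mulmxDl) !mulmxA mul_mx_scalar -scalemxAl.
Qed.

Lemma jwi_swap c d u v x : jwi c d (u ++ false :: true :: v) x =
  jwi c d (u ++ true :: false :: v) x + \sum_e jwi c e u x * jwi e d v x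
  + tau * jwi c d (u ++ v) x.
Proof.
rewrite /jwi word_swap !(mulmxDr, mulmxDl) mxE [X in X + _]mxE; congr (_ + _ + _).
  set W := word_mx _ u; set W' := word_mx _ v.
  transitivity ((qj (sval x) *m W *m qi (sval x) *m (qj (sval x) *m W' *m qi (sval x))) c d).
    by rewrite !mulmxA.
  by rewrite mxE.
by rewrite -scalemxAr -scalemxAl mxE.
Qed.

Lemma trw_swap u v x : trw (u ++ false :: true :: v) x =
  trw (u ++ true :: false :: v) x + \sum_e jwi e e (v ++ u) x + tau * trw (u ++ v) x.
Proof.
rewrite /trw word_swap !mxtraceD mxtraceZ; congr (_ + _ + _).
by rewrite mxtrace_mulC !mulmxA /mxtrace /jwi word_mx_cat !mulmxA.
Qed.

Section Reordering.
(** A function phi of words that changes by elements of S when adjacent letters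
    are exchanged depends, modulo S, on the number of letters of each kind only.
    Restricting to words of one length n allows the use in an induction on n. *)
Variables (phi : seq bool -> level -> C) (n : nat).
Hypothesis phi_swap : forall u v, (size u + size v).+2 = n ->
  S (fun x => phi (u ++ false :: true :: v) x - phi (u ++ true :: false :: v) x).

Definition canonical_word p q := nseq p false ++ nseq q true.

Let eqS w w' := S (fun x => phi w x - phi w' x).

Let eqS_refl w : eqS w w.
Proof. by apply: S_eq (subalg_cst SA 0) _ => x; rewrite subrr. Qed.

Let eqS_sym w w' : eqS w w' -> eqS w' w.
Proof. by move=> /(subalg_opp SA) h; apply: S_eq h _ => x; rewrite opprB. Qed.

Let eqS_trans w1 w2 w3 : eqS w1 w2 -> eqS w2 w3 -> eqS w1 w3.
Proof.
move=> h12 h23; apply: S_eq (subalg_add SA h12 h23) _ => x.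
by rewrite addrA subrK.
Qed.

Let move_right u p v : (size u + p + size v).+1 = n ->
  eqS (u ++ true :: nseq p false ++ v) (u ++ nseq p false ++ true :: v).
Proof.
elim: p u => [|p IH] u sz /=; first exact: eqS_refl.
apply: (@eqS_trans _ (u ++ false :: true :: nseq p false ++ v)).
  apply/eqS_sym/phi_swap; by rewrite size_cat size_nseq -sz addnS addSn addnA.
have := IH (rcons u false); rewrite !cat_rcons size_rcons; apply.
by rewrite -sz addSn addnS.
Qed.

Lemma reorder w : size w = n ->
  S (fun x => phi w x - phi (canonical_word (count_mem false w) (count_mem true w)) x).
Proof.
rewrite -[w]/([::] ++ w) -/(eqS _ _).
suff H u : size (u ++ w) = n ->
    eqS (u ++ w) (u ++ canonical_word (count_mem false w) (count_mem true w)).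
  by move=> sz; exact: (H [::]).
elim: w u => [|b w IH] u sz; first exact: eqS_refl.
have /IH : size (rcons u b ++ w) = n by rewrite cat_rcons.
rewrite !cat_rcons => h; apply: eqS_trans h _.
case: b sz => sz; last exact: eqS_refl.
rewrite /= add0n add1n /canonical_word; apply: move_right.
rewrite size_nseq -sz size_cat /= -(count_predC (pred1 false) w).
have -> : count (predC (pred1 false)) w = count_mem true w by apply: eq_count => -[].
by rewrite addnS addnA.
Qed.

End Reordering.

Lemma word_mx_nseq_eq Lab Lab' (Y : Lab -> 'M[C]_k) (Y' : Lab' -> 'M[C]_k) l l' n :
  Y l = Y' l' -> word_mx Y (nseq n l) = word_mx Y' (nseq n l').
Proof. by move=> e; rewrite !word_mx_nseq e. Qed.

Lemma row_mul_colE (J : 'M[C]_(2, k)) (W : 'M_k) (I : 'M_(k, 2)) c d :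
  (row c J *m W *m col d I) 0 0 = (J *m W *m I) c d.
Proof. by rewrite -row_mul colE mulmxA -colE mxE -row_mul mxE. Qed.

Lemma liftable_trA p : liftable (trA C k p).
Proof.
split; first exact: tr_word_invariant.
apply: S_invQ; exists (trM C k p); first exact: trM_invariant.
apply/funext => x; rewrite trM_eval /restr quad_eval_tr mx_eval_word.
by congr (\tr _); apply: word_mx_nseq_eq.
Qed.

Lemma liftable_trB p : liftable (\tr (word_mx (genAB C k) (nseq p true))).
Proof.
split; first exact: tr_word_invariant.
apply: S_invQop; exists (trM C k p); first exact: trM_invariant.
apply/funext => x; rewrite trM_eval /restr quad_eval_tr mx_eval_word.
by congr (\tr _); apply: word_mx_nseq_eq.
Qed.

Lemma liftable_j1i0 : liftable (j1i0 C k).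
Proof.
have -> : j1i0 C k = (genj C k *m word_mx (genAB C k) [::] *m geni C k) 1 0.
  by rewrite /= mulmx1.
split; first exact: jwi_invariant.
apply: S_invQ; exists (wMv C k 0); first exact: wMv_invariant.
by apply/funext => x; rewrite wMv_eval /restr jwi_eval row_mul_colE.
Qed.

Lemma liftable_j0Bi1 p :
  liftable ((genj C k *m word_mx (genAB C k) (nseq p true) *m geni C k) 0 1).
Proof.
split; first exact: jwi_invariant.
apply: S_invQop; exists (wMv C k p); first exact: wMv_invariant.
apply/funext => x; rewrite wMv_eval /restr jwi_eval row_mul_colE.
by congr ((_ *m _ *m _) _ _); apply: word_mx_nseq_eq.
Qed.

Let restr_jwi w c d x :
  restr ((genj C k *m word_mx (genAB C k) w *m geni C k) c d) x = jwi c d w x.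
Proof. exact: jwi_eval. Qed.

Let natr_neq0 n : n.+1%:R != 0 :> C. Proof. by rewrite pnatr_eq0. Qed.

Let S_divn n f : S (fun x => f x *+ n.+1) -> S f.
Proof.
move=> Sf; apply: S_eq (subalg_scale SA (n.+1%:R^-1) Sf) _ => x.
by rewrite -[f x *+ _]mulr_natl mulKf.
Qed.

(** With beta the matrix j B^q i and e the bracket with j_1 i_0, the entry (0, 1)
    of beta is given, e maps it to the difference of the diagonal entries, and
    maps this difference to -2 times the entry (1, 0).  The sum of the diagonal
    entries comes from the trace of the moment equation multiplied by B^q. *)
Lemma S_jBi q c d : S (jwi c d (nseq q true)).
Proof.
pose beta := genj C k *m word_mx (genAB C k) (nseq q true) *m geni C k.
have b01 : liftable (beta 0 1) by exact: liftable_j0Bi1.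
have bE (y e : 'I_2) : bracket (j1i0 C k) (beta y e) =
    beta y 0 * (e == 1)%:R - (y == 0)%:R * beta 1 e.
  transitivity (map_mx (bracket (j1i0 C k)) beta y e); first by rewrite [RHS]mxE.
  by rewrite bracket_j1i0_jBi mxE [X in _ + X]mxE mulmx_deltaE delta_mulmxE.
have diff : liftable (beta 0 0 - beta 1 1).
  by have := liftable_bracket liftable_j1i0 b01; rewrite bE !eqxx mulr1 mul1r.
have b10 : S (jwi 1 0 (nseq q true)).
  have [_] := liftable_bracket liftable_j1i0 diff.
  rewrite (der_sub (bracket_derivation _)) !bE /= !(mulr0, mulr1, mul0r, mul1r, subr0, sub0r).
  move=> /(subalg_opp SA) Sb; apply: (@S_divn 1); apply: S_eq Sb _ => x.
  by rewrite -restr_jwi /restr quad_evalB quad_evalN opprB opprK mulr2n.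
have Sdiff : S (fun x => jwi 0 0 (nseq q true) x - jwi 1 1 (nseq q true) x).
  by apply: S_eq diff.2 _ => x; rewrite -!restr_jwi /restr quad_evalB.
have Ssum : S (fun x => jwi 0 0 (nseq q true) x + jwi 1 1 (nseq q true) x).
  apply: S_eq (subalg_scale SA (- tau) (liftable_trB q).2) _ => x.
  have := trw_swap (nseq q true) [::] x.
  rewrite big_ord_recl big_ord1 /= cats0 /restr quad_eval_tr mx_eval_word -/(trw _ _).
  have -> : lift ord0 ord0 = 1 :> 'I_2 by apply/val_inj.
  have -> : trw (nseq q true ++ [:: false; true]) x = trw (nseq q true ++ [:: true; false]) x.
    rewrite /trw !word_mx_cat /= !mulmx1 !mulmxA mxtrace_mulC mulmxA; congr (\tr (_ *m _)).
    rewrite !word_mx_nseq -[LHS]/(iter q.+1 _ _) iterSr.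
    elim: q {beta b01 bE diff b10 Sdiff} => [|q IH] /=; first by rewrite mulmx1 mul1mx.
    by rewrite IH mulmxA.
  rewrite -addrA -{1}[trw _ x]addr0 => /addrI h.
  by rewrite mulNr; apply/eqP; rewrite -addr_eq0 -h.
have two (c' : 'I_2) : (c' == 0) || (c' == 1) by case: c' => -[|[]].
case/orP: (two c) => /eqP ->; case/orP: (two d) => /eqP -> //.
- apply: (@S_divn 1); apply: S_eq (subalg_add SA Ssum Sdiff) _ => x.
  by rewrite mulr2n; ring.
- by apply: S_eq b01.2 _ => x; rewrite restr_jwi.
- apply: (@S_divn 1); apply: S_eq (subalg_sub SA Ssum Sdiff) _ => x.
  by rewrite mulr2n; ring.
Qed.

(** Induction on the length of w.  Modulo shorter words, the q+1 words in the
    bracket of tr A^(p+1) and j_c B^(q+1) i_d are all equal to A^p B^q. *)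
Lemma S_jwi c d w : S (jwi c d w).
Proof.
have [n] := ubnP (size w); elim: n w c d => // n IH w c d; rewrite ltnS => sw.
have swap u v : (size u + size v).+2 = size w ->
    S (fun x => jwi c d (u ++ false :: true :: v) x - jwi c d (u ++ true :: false :: v) x).
  move=> sz; apply: S_eq (subalg_add SA
    (subalg_sum SA (index_enum 'I_2) (fun e => subalg_mul SA (IH u c e _) (IH v e d _)))
    (subalg_scale SA tau (IH (u ++ v) c d _))) _; rewrite ?size_cat; try lia.
  by move=> x; rewrite jwi_swap; ring.
have cw := reorder swap erefl.
set p := count_mem false w in cw *; set q := count_mem true w in cw *.
suff Sc : S (jwi c d (canonical_word p q)).
  by apply: S_eq (subalg_add SA cw Sc) _ => x; rewrite subrK.
have pq : (p + q)%N = size w.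
  by rewrite -(count_predC (pred1 false) w); congr (_ + _)%N; apply: eq_count => -[].
have Sb : S (restr ((genj C k *m word_mx (genAB C k) (nseq q.+1 true) *m geni C k) c d)).
  by apply: S_eq (S_jBi q.+1 c d) _ => x; rewrite restr_jwi.
have [_] := liftable_bracket (liftable_trA p.+1) (conj (jwi_invariant _ c d) Sb).
rewrite bracket_trA_jBi => Ssum.
have {}Ssum : S (fun x => \sum_(r < q.+1)
    jwi c d (nseq r true ++ nseq p false ++ nseq (q - r) true) x).
  apply: (@S_divn p); apply: S_eq Ssum _ => x.
  rewrite /restr quad_evalMn quad_eval_sum; congr (_ *+ _).
  by apply: eq_bigr => r _; rewrite -restr_jwi.
have move_r (r : 'I_q.+1) : S (fun x =>
    jwi c d (nseq r true ++ nseq p false ++ nseq (q - r) true) x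
    - jwi c d (canonical_word p q) x).
  have := ltn_ord r; set w' := _ ++ _; move=> ltrq.
  have cF : count_mem false w' = p by rewrite !count_cat !count_nseq /=; lia.
  have cT : count_mem true w' = q by rewrite !count_cat !count_nseq /=; lia.
  have sz : size w' = size w by rewrite !size_cat !size_nseq -pq; lia.
  by have := reorder swap sz; rewrite cF cT.
apply: (@S_divn q).
apply: S_eq (subalg_sub SA Ssum (subalg_sum SA (index_enum 'I_q.+1) move_r)) _ => x.
by rewrite sumrB opprB addrC subrK sumr_const card_ord.
Qed.

(** As for S_jwi; here exchanging letters produces functions j_c w i_d, which are
    already known to be in S. *)
Lemma S_trw w : S (trw w).
Proof.
have [n] := ubnP (size w); elim: n w => // n IH w; rewrite ltnS => sw.
have swap u v : (size u + size v).+2 = size w ->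
    S (fun x => trw (u ++ false :: true :: v) x - trw (u ++ true :: false :: v) x).
  move=> sz; apply: S_eq (subalg_add SA
    (subalg_sum SA (index_enum 'I_2) (fun e => S_jwi e e (v ++ u)))
    (subalg_scale SA tau (IH (u ++ v) _))) _; rewrite ?size_cat; try lia.
  by move=> x; rewrite trw_swap; ring.
have cw := reorder swap erefl.
set p := count_mem false w in cw *; set q := count_mem true w in cw *.
have pq : (p + q)%N = size w.
  by rewrite -(count_predC (pred1 false) w); congr (_ + _)%N; apply: eq_count => -[].
have Sc : S (trw (nseq q true ++ nseq p false)).
  have [_] := liftable_bracket (liftable_trA p.+1) (liftable_trB q.+1).
  rewrite bracket_trA_trB => Sc; apply: (@S_divn p); apply: (@S_divn q).
  by apply: S_eq Sc _ => x; rewrite /restr !quad_evalMn quad_eval_tr mx_eval_word.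
set w' := _ ++ _ in Sc.
have cF : count_mem false w' = p by rewrite count_cat !count_nseq /=; lia.
have cT : count_mem true w' = q by rewrite count_cat !count_nseq /=; lia.
have sz : size w' = size w by rewrite size_cat !size_nseq -pq; lia.
have := reorder swap sz; rewrite cF cT => cw'.
apply: S_eq (subalg_add SA (subalg_sub SA cw cw') Sc) _ => x.
by ring.
Qed.

End PoissonGeneration.

(** * Regular functions are polynomials in words *)

Section LevelAction.
Variables (C : comUnitRingType) (k : nat) (tau : C).

Lemma mu_act (g : 'M[C]_k) z : g \in unitmx -> mu (quad_act g z) = g *m mu z *m invmx g.
Proof.
move=> ug; rewrite /mu /= !(mulmxBr, mulmxBl) !mulmxA !(mulmxKV ug).
by [].
Qed.

Lemma level_actP (g : 'M[C]_k) (x : level k tau) : g \in unitmx ->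
  mu (quad_act g (sval x)) = tau%:M.
Proof.
move=> ug; rewrite mu_act // (svalP x) mul_mx_scalar -scalemxAl mulmxV //.
by rewrite scale_scalar_mx mulr1.
Qed.

Definition level_act (g : 'M[C]_k) (ug : g \in unitmx) (x : level k tau) : level k tau :=
  exist _ (quad_act g (sval x)) (level_actP x ug).

End LevelAction.

Section Slots.
Variables (C : numFieldType) (k : nat).
Implicit Types (z : quad C k).

(** The labels of the matrices 1, A, B and i_c j_d, on which GL(k) acts by
    conjugation.  The label of 1 serves to pad monomials to a common degree. *)
Definition slot_label : finType := (unit + bool + 'I_2 * 'I_2)%type.

Definition slotmx z (l : slot_label) : 'M[C]_k :=
  match l with
  | inl (inl _) => 1%:M
  | inl (inr b) => quadAB z b
  | inr (c, d) => col c (qi z) *m row d (qj z)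
  end.

Lemma slotmx_act g z l : g \in unitmx ->
  slotmx (quad_act g z) l = g *m slotmx z l *m invmx g.
Proof.
move=> ug; case: l => [[_|[]]|[c d]] //=; first by rewrite mulmx1 mulmxV.
by rewrite !colE row_mul -!mulmxA.
Qed.

Definition is_i (v : quad_var k) := if v is inl (inr _) then true else false.
Definition is_j (v : quad_var k) := if v is inr _ then true else false.

Definition slot_entry z (e : slot_label * ('I_k * 'I_k)) := slotmx z e.1 e.2.1 e.2.2.

(** Only the i- and j-entries are left to be paired. *)
Lemma split_monomial (s : seq (quad_var k)) :
  exists (l : seq (slot_label * ('I_k * 'I_k)))
    (li : seq ('I_k * 'I_2)) (lj : seq ('I_2 * 'I_k)),
  [/\ size li = count is_i s, size lj = count is_j s,
      (size l + size li <= size s)%N &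
      forall z, \prod_(v <- s) quad_coord z v =
        (\prod_(e <- l) slot_entry z e) * (\prod_(e <- li) qi z e.1 e.2)
        * \prod_(e <- lj) qj z e.1 e.2].
Proof.
elim: s => [|v s [l [li [lj [si sj sl E]]]]].
  by exists [::], [::], [::]; split=> // z; rewrite !big_nil !mulr1.
case: v => [[[[a b]|[a b]]|[a c]]|[c a]].
- exists ((inl (inr false), (a, b)) :: l), li, lj; split=> //= z.
  by rewrite !big_cons E /slot_entry /=; ring.
- exists ((inl (inr true), (a, b)) :: l), li, lj; split=> //= z.
  by rewrite !big_cons E /slot_entry /=; ring.
- exists l, ((a, c) :: li), lj; split=> //=; rewrite ?si ?sj ?addnS //.
    by rewrite -si.
  by move=> z; rewrite !big_cons E /=; ring.
- exists l, li, ((c, a) :: lj); split=> //=; rewrite ?si ?sj //.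
    by rewrite -si leqW.
  by move=> z; rewrite !big_cons E /=; ring.
Qed.

Lemma pair_ij (li : seq ('I_k * 'I_2)) (lj : seq ('I_2 * 'I_k)) :
  size li = size lj ->
  exists2 l, size l = size li &
    forall z, (\prod_(e <- li) qi z e.1 e.2) * (\prod_(e <- lj) qj z e.1 e.2)
              = \prod_(e <- l) slot_entry z e.
Proof.
elim: li lj => [|[a c] li IH] [|[d b] lj] //= => [_|[/IH [l sl E]]].
  by exists [::] => // z; rewrite !big_nil mulr1.
exists ((inr (c, d), (a, b)) :: l) => [|z]; first by rewrite /= sl.
rewrite !big_cons -E /slot_entry /= [X in _ = X * _]mxE big_ord1 !mxE; ring.
Qed.

Lemma balanced_monomial (s : seq (quad_var k)) : count is_i s = count is_j s ->
  exists2 l, (size l <= size s)%N &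
    forall z, \prod_(v <- s) quad_coord z v = \prod_(e <- l) slot_entry z e.
Proof.
have [l [li [lj [si sj sl E]]]] := split_monomial s.
move=> bal; have [l' sl' E'] : exists2 l, size l = size li & forall z,
    (\prod_(e <- li) qi z e.1 e.2) * (\prod_(e <- lj) qj z e.1 e.2)
    = \prod_(e <- l) slot_entry z e by apply: pair_ij; rewrite si sj.
exists (l ++ l') => [|z]; first by rewrite size_cat sl'.
by rewrite E -mulrA E' big_cat.
Qed.

Lemma pad_prod (T : Type) (G : T -> C) d (l : seq T) N : G d = 1 -> (size l <= N)%N ->
  \prod_(e <- l) G e = \prod_(i < N) G (nth d l i).
Proof.
move=> Gd; elim: N l => [|N IH] [|e l] //= sl.
- by rewrite big_nil big_ord0.
- by rewrite big_nil big1 // => i _; rewrite nth_nil.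
- by rewrite big_cons big_ord_recl (IH l).
Qed.

End Slots.

Section Monomials.
Variables (C : comNzRingType) (J : finType).

(** The variables of a monomial, with multiplicity, so that a monomial can be
    split and paired by operations on sequences. *)
Definition mon_seq (m : 'X_{1..#|J|}) : seq J :=
  flatten [seq nseq (m i) (enum_val i) | i <- enum 'I_#|J|].

Lemma evalOn_monomials (F : polyOn C J) x :
  evalOn F x = \sum_(m <- msupp F) F@_m * \prod_(v <- mon_seq m) x v.
Proof.
rewrite /evalOn mevalE; apply: eq_bigr => m _; congr (_ * _).
rewrite big_flatten big_map big_enum; apply: eq_bigr => i _.
by elim: (m i) => [|n IH]; rewrite ?big_nil ?expr0 // big_cons exprS IH.
Qed.

End Monomials.

Section RegularFunctions.
Variables (C : numClosedFieldType) (k : nat) (tau : C).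
Hypothesis k_gt0 : (0 < k)%N.
Local Notation level := (level k tau).

Let bal (m : 'X_{1..#|quad_var k|}) :=
  count (@is_i k) (mon_seq m) == count (@is_j k) (mon_seq m).

Lemma torus_coord t (z : quad C k) v : t != 0 ->
  quad_coord (quad_act t%:M z) v = t ^+ is_i v * t^-1 ^+ is_j v * quad_coord z v.
Proof.
move=> t0; have inv : invmx (t%:M : 'M[C]_k) = t^-1%:M by rewrite invmx_scalar.
case: v => [[[[a b]|[a b]]|[a c]]|[c a]]; rewrite /= ?inv ?mul_mx_scalar ?mul_scalar_mx !mxE
  ?expr0 ?expr1 ?mul1r ?mulr1 //.
all: by rewrite mulKf.
Qed.

Lemma torus_monomial t (z : quad C k) s : t != 0 ->
  \prod_(v <- s) quad_coord (quad_act t%:M z) v =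
  t ^+ count (@is_i k) s * t^-1 ^+ count (@is_j k) s * \prod_(v <- s) quad_coord z v.
Proof.
move=> t0; elim: s => [|v s IH]; first by rewrite !big_nil !expr0 !mulr1.
by rewrite !big_cons IH torus_coord //= !exprD; ring.
Qed.

(** For a scalar matrix t, the value f x is both constant in t and a Laurent
    polynomial in t; comparing the constant terms leaves the balanced monomials.
    Multiplication by t^N makes it a polynomial identity, and N exceeds all
    negative exponents so that it also holds at t = 0. *)
Lemma balanced_part (F : polyOn C (quad_var k)) (f : level -> C) (x : level) :
  f = restr F ->
  (forall (g : 'M[C]_k) (x y : level), g \in unitmx ->
     sval y = quad_act g (sval x) -> f y = f x) ->
  f x = \sum_(m <- msupp F | bal m) F@_m * \prod_(v <- mon_seq m) quad_coord (sval x) v.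
Proof.
move=> fF finv.
pose N := (\max_(m <- msupp F) count (@is_j k) (mon_seq m)).+1.
pose c m := F@_m * \prod_(v <- mon_seq m) quad_coord (sval x) v.
pose p : {poly C} := \sum_(m <- msupp F)
  c m *: 'X^(N + count (@is_i k) (mon_seq m) - count (@is_j k) (mon_seq m)).
have leN m : m \in msupp F -> (count (@is_j k) (mon_seq m) < N)%N.
  by move=> mF; rewrite ltnS; apply: leq_bigmax_seq.
have pE : p = f x *: 'X^N.
  apply: poly_nat_inj => n; rewrite hornerZ hornerXn /p -horner_evalE rmorph_sum /=.
  have [->|n0] := posnP n.
    rewrite expr0n /= mulr0 big_seq big1 // => m mF.
    rewrite horner_evalE hornerZ hornerXn expr0n.
    case E: (_ - _)%N => [|j]; last by rewrite mulr0.
    by move/eqP: E; rewrite subn_eq0 leqNgt (leq_trans (leN m mF) (leq_addr _ _)).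
  have t0 : n%:R != 0 :> C by rewrite pnatr_eq0 -lt0n.
  have ut : (n%:R%:M : 'M[C]_k) \in unitmx by rewrite unitmxE det_scalar unitfE expf_neq0.
  have <- : f (level_act ut x) = f x by apply: (finv _ _ _ ut).
  rewrite [in RHS]fF /restr /quad_eval evalOn_monomials mulr_suml.
  rewrite big_seq [RHS]big_seq; apply: eq_bigr => m mF.
  rewrite horner_evalE hornerZ hornerXn torus_monomial // /c.
  have lem := ltnW (leN m mF).
  have -> : n%:R ^+ N = n%:R ^+ (N - count (@is_j k) (mon_seq m)) *
     n%:R ^+ count (@is_j k) (mon_seq m) :> C by rewrite -exprD subnK.
  rewrite -addnC -addnBA // exprD exprVn.
  have t1 : n%:R ^+ count (@is_j k) (mon_seq m) != 0 :> C by rewrite expf_neq0.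
  move: (n%:R ^+ count (@is_j k) (mon_seq m)) t1 => tj tj0.
  move: (n%:R ^+ count (@is_i k) (mon_seq m)) (n%:R ^+ (N - _)) => ti tN.
  move: (F@_m) (\prod_(v <- _) _) => Fm Pm.
  by field.
have := congr1 (fun q : {poly C} => q`_N) pE.
rewrite coefZ coefXn eqxx mulr1 => <-.
rewrite coef_sum [RHS]big_mkcond /= big_seq [RHS]big_seq; apply: eq_bigr => m mF.
rewrite coefZ coefXn /bal -/(c m).
have -> : (N == N + count (@is_i k) (mon_seq m) - count (@is_j k) (mon_seq m))%N =
   (count (@is_i k) (mon_seq m) == count (@is_j k) (mon_seq m)).
  have lem := ltnW (leN m mF).
  rewrite -(eqn_add2r (count (@is_j k) (mon_seq m))) subnK ?eqn_add2l 1?eq_sym //.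
  exact: leq_trans lem (leq_addr _ _).
by case: eqP; rewrite ?mulr1 ?mulr0.
Qed.

(** All balanced monomials are padded to the same number N of slots by the entry
    (o, o) of the identity matrix, which is 1. *)
Lemma tensor_form (F : polyOn C (quad_var k)) :
  exists N (v : {ffun 'I_N -> slot_label} -> {ffun 'I_N -> 'I_k} -> {ffun 'I_N -> 'I_k} -> C),
  forall z, \sum_(m <- msupp F | bal m) F@_m * \prod_(v <- mon_seq m) quad_coord z v =
    \sum_l \sum_a \sum_b v l a b * tensor_prod (fun s => slotmx z (l s)) a b.
Proof.
pose N := (\max_(m <- msupp F) size (mon_seq m))%N.
pose o : 'I_k := Ordinal k_gt0.
pose K := ({ffun 'I_N -> slot_label} * ({ffun 'I_N -> 'I_k} * {ffun 'I_N -> 'I_k}))%type.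
have ex m : exists q : K, m \in msupp F -> bal m -> forall z : quad C k,
    \prod_(v <- mon_seq m) quad_coord z v =
    tensor_prod (fun s => slotmx z (q.1 s)) q.2.1 q.2.2.
  pose d : slot_label * ('I_k * 'I_k) := (inl (inl tt), (o, o)).
  have [/andP[mF bm]|] := boolP ((m \in msupp F) && bal m); last first.
    move=> nb; exists ([ffun=> d.1], ([ffun=> o], [ffun=> o])) => mF bm.
    by rewrite mF bm in nb.
  have [l sl E] := @balanced_monomial C k _ (eqP bm).
  exists ([ffun s : 'I_N => (nth d l s).1],
    ([ffun s : 'I_N => (nth d l s).2.1], [ffun s : 'I_N => (nth d l s).2.2])).
  move=> _ _ z; rewrite E (@pad_prod _ _ _ d _ N); first 1 last.
  - by rewrite /slot_entry /= mxE eqxx.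
  - apply: leq_trans sl _; exact: leq_bigmax_seq.
  by apply: eq_bigr => s _; rewrite !ffunE.
have [q qE] := choice ex.
exists N, (fun l a b => \sum_(m <- msupp F | bal m) F@_m * ((l, (a, b)) == q m)%:R) => z.
pose T (r : K) := tensor_prod (fun s => slotmx z (r.1 s)) r.2.1 r.2.2.
transitivity (\sum_(r : K) (\sum_(m <- msupp F | bal m) F@_m * (r == q m)%:R) * T r).
  under [RHS]eq_bigr do rewrite mulr_suml.
  rewrite exchange_big /= big_seq_cond [RHS]big_seq_cond; apply: eq_bigr => m /andP[mF bm].
  rewrite (qE m mF bm) (bigD1 (q m)) //= big1 => [|r /negbTE ne].
    by rewrite eqxx mulr1 addr0.
  by rewrite ne mulr0 mul0r.
under [RHS]eq_bigr do rewrite pair_bigA /=.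
by rewrite pair_bigA; apply: eq_bigr => -[l [a b]].
Qed.

Variable S : (level -> C) -> Prop.
Hypothesis SA : subalgebra S.
Hypothesis S_jwi : forall c d w, S (jwi c d w).
Hypothesis S_trw : forall w, S (trw w).

Let W (u : seq bool) (x : level) := word_mx (quadAB (sval x)) u.
Let V (s : seq slot_label) (x : level) := word_mx (slotmx (sval x)) s.

Let W_rcons u b x : W (rcons u b) x = W u x *m quadAB (sval x) b.
Proof. by rewrite /W -cats1 word_mx_cat /= mulmx1. Qed.

Let V_map u x : V (map (fun b => inl (inr b)) u) x = W u x.
Proof. by rewrite /V /W; elim: u => //= b u ->. Qed.

(** A letter i_e j_e' cuts the scalar j_c w i_d into a product of two scalars of
    the same kind. *)
Lemma slot_word_ji s u c d :
  S (fun x => (qj (sval x) *m W u x *m V s x *m qi (sval x)) c d).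
Proof.
elim: s u c d => [|[[[]|b]|[e e']] s IH] u c d.
- by apply: subalg_eq (S_jwi c d u) _ => x; rewrite mulmx1.
- by apply: subalg_eq (IH u c d) _ => x; rewrite /V /= mul1mx.
- by apply: subalg_eq (IH (rcons u b) c d) _ => x; rewrite W_rcons /V /= !mulmxA.
- apply: subalg_eq (subalg_mul SA (S_jwi c e u) (IH [::] e' d)) _ => x.
  rewrite /V /= -!mulmxA.
  transitivity ((qj (sval x) *m W u x *m col e (qi (sval x)) *m
                 (row e' (qj (sval x)) *m (V s x *m qi (sval x)))) c d).
    by rewrite /V !mulmxA.
  rewrite mxE big_ord1 colE mulmxA -colE -row_mul /jwi mul1mx.
  by rewrite [col _ _ _ _]mxE [row _ _ _ _]mxE.
Qed.

(** A letter i_e j_e' in a trace can be moved to the end by cyclicity; the trace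
    then becomes a scalar j_e' w i_e. *)
Lemma slot_word_trace s u : S (fun x => \tr (W u x *m V s x)).
Proof.
elim: s u => [|[[[]|b]|[e e']] s IH] u.
- by apply: subalg_eq (S_trw u) _ => x; rewrite mulmx1.
- by apply: subalg_eq (IH u) _ => x; rewrite /V /= mul1mx.
- by apply: subalg_eq (IH (rcons u b)) _ => x; rewrite W_rcons /V /= !mulmxA.
- apply: subalg_eq (slot_word_ji (s ++ map (fun b => inl (inr b)) u) [::] e' e) _ => x.
  rewrite /W /V /= mulmx1 word_mx_cat -!/(V _ _) V_map.
  rewrite mxtrace_mulC -!mulmxA mxtrace_mulC trace_mx11.
  by rewrite row_mul_colE !mulmxA.
Qed.

(** The balanced part of F is constant along the orbits of points of the level
    set, being equal to f there, and is a polynomial in the slot matrices. *)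
Theorem regN_subalgebra (f : level -> C) : regN f -> S f.
Proof.
move=> [[F fF] finv].
have [N [v vE]] := tensor_form F.
apply: (@conjugation_invariants C k level slot_label (fun x => slotmx (sval x)) S SA _ N v).
  move=> w; apply: subalg_eq (slot_word_trace w [::]) _ => x.
  by rewrite mul1mx.
move=> x g ug; rewrite -(finv g x (level_act ug x)) // (balanced_part _ fF) // vE.
apply: eq_bigr => l _; apply: eq_bigr => a _; apply: eq_bigr => b _; congr (_ * _).
by apply: eq_bigr => s _; rewrite slotmx_act.
Qed.

End RegularFunctions.

(** * The two quiver subalgebras and the Poisson algebra they generate *)

Section Regular.
Variables (C : numClosedFieldType) (k : nat) (tau : C).
Local Notation level := (level k tau).

Lemma regN_poisson_subalg : poisson_subalgN (@regN C k tau).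
Proof.
split; first split.
- by [].
- move=> c; split=> //; exists c%:MP; apply/funext => x.
  by rewrite /restr /quad_eval /evalOn mevalC.
- move=> f g [[F fF] fi] [[G gG] gi]; split.
    by exists (F + G); apply/funext => x; rewrite fF gG /restr quad_evalD.
  by move=> h x y uh e; rewrite (fi h x y uh e) (gi h x y uh e).
- move=> f g [[F fF] fi] [[G gG] gi]; split.
    by exists (F * G); apply/funext => x; rewrite fF gG /restr quad_evalM.
  by move=> h x y uh e; rewrite (fi h x y uh e) (gi h x y uh e).
move=> f g h _ _ [F [G [Fi Gi _ _ ->]]]; split; first by exists (bracket F G).
move=> u x y uu e; rewrite /restr e.
exact: bracket_invariant.
Qed.

Section Quiver.
(** The representation spaces of the quiver and of its opposite are treated
    together: e is the inclusion of their coordinates, and its image is isotropic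
    for the bracket. *)
Variables (pr : quad C k -> qrep C k) (e : qrep_var k -> quad_var k).
Hypothesis pr_coord : forall z v, qrep_coord (pr z) v = quad_coord z (e v).
Hypothesis pr_act : forall g z, pr (quad_act g z) = qrep_act g (pr z).
Hypothesis isotropic : forall F G : polyOn C (qrep_var k),
  bracket (renameOn e F) (renameOn e G) = 0.

Definition quiver_function (f : level -> C) : Prop :=
  exists2 F : polyOn C (qrep_var k), qrep_invariant F &
    f = fun x => qrep_eval F (pr (sval x)).

Lemma quad_eval_rename (F : polyOn C (qrep_var k)) z :
  quad_eval (renameOn e F) z = qrep_eval F (pr z).
Proof.
rewrite /quad_eval evalOn_rename; apply: meval_eq => l.
by rewrite pr_coord.
Qed.

Lemma quiver_function_reg f : quiver_function f -> regN f.
Proof.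
move=> [F Fi ->]; split.
  by exists (renameOn e F); apply/funext => x; rewrite /restr quad_eval_rename.
by move=> g x y ug ->; rewrite pr_act Fi.
Qed.

Lemma quiver_functions_commutative : commutative_poisson_subalgN quiver_function.
Proof.
split; first split.
- exact: quiver_function_reg.
- move=> c; exists c%:MP => [g r ug|]; last apply/funext => x;
  by rewrite /qrep_eval /evalOn !mevalC.
- move=> _ _ [F Fi ->] [G Gi ->]; exists (F + G) => [g r ug|].
    by rewrite [LHS]mevalD [RHS]mevalD; congr (_ + _); [apply: Fi|apply: Gi].
  by apply/funext => x; rewrite [RHS]mevalD.
- move=> _ _ [F Fi ->] [G Gi ->]; exists (F * G) => [g r ug|].
    by rewrite [LHS]mevalM [RHS]mevalM; congr (_ * _); [apply: Fi|apply: Gi].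
  by apply/funext => x; rewrite [RHS]mevalM.
move=> _ _ [F Fi ->] [G Gi ->].
exists (renameOn e F), (renameOn e G); split.
- by move=> g z ug; rewrite !quad_eval_rename pr_act Fi.
- by move=> g z ug; rewrite !quad_eval_rename pr_act Gi.
- by apply/funext => x; rewrite /restr quad_eval_rename.
- by apply/funext => x; rewrite /restr quad_eval_rename.
- by apply/funext => x; rewrite /restr isotropic quad_eval0.
Qed.

End Quiver.

Definition varQ (v : qrep_var k) : quad_var k :=
  match v with
  | inl (inl (a, b)) => varA a b
  | inl (inr a) => vari a 0
  | inr a => varj 1 a
  end.

Definition varQop (v : qrep_var k) : quad_var k :=
  match v with
  | inl (inl (a, b)) => varB a b
  | inl (inr a) => vari a 1
  | inr a => varj 0 a
  end.

Lemma ord2_cases (c : 'I_2) : c = 0 \/ c = 1.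
Proof. by case: c => -[|[|//]] ?; [left|right]; apply/val_inj. Qed.

Lemma bracket_varQ (F G : polyOn C (qrep_var k)) :
  bracket (renameOn varQ F) (renameOn varQ G) = 0.
Proof.
have dB (H : polyOn C (qrep_var k)) a b : derivOn (varB a b) (renameOn varQ H) = 0.
  by apply: derivOn_rename => -[[[? ?]|?]|?].
have di (H : polyOn C (qrep_var k)) a : derivOn (vari a 1) (renameOn varQ H) = 0.
  by apply: derivOn_rename => -[[[? ?]|?]|?] //=; apply/eqP => -[].
have dj (H : polyOn C (qrep_var k)) a : derivOn (varj 0 a) (renameOn varQ H) = 0.
  by apply: derivOn_rename => -[[[? ?]|?]|?] //=; apply/eqP => -[].
rewrite /bracket big1 ?add0r => [|a _]; last first.
  by rewrite big1 // => b _; rewrite !dB mulr0 mul0r subrr.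
rewrite big1 // => c _; rewrite big1 // => a _.
by have [->|->] := ord2_cases c; rewrite ?di ?dj !(mulr0, mul0r) subrr.
Qed.

Lemma bracket_varQop (F G : polyOn C (qrep_var k)) :
  bracket (renameOn varQop F) (renameOn varQop G) = 0.
Proof.
have dA (H : polyOn C (qrep_var k)) a b : derivOn (varA a b) (renameOn varQop H) = 0.
  by apply: derivOn_rename => -[[[? ?]|?]|?].
have di (H : polyOn C (qrep_var k)) a : derivOn (vari a 0) (renameOn varQop H) = 0.
  by apply: derivOn_rename => -[[[? ?]|?]|?] //=; apply/eqP => -[].
have dj (H : polyOn C (qrep_var k)) a : derivOn (varj 1 a) (renameOn varQop H) = 0.
  by apply: derivOn_rename => -[[[? ?]|?]|?] //=; apply/eqP => -[].
rewrite /bracket big1 ?add0r => [|a _]; last first.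
  by rewrite big1 // => b _; rewrite !dA mulr0 mul0r subrr.
rewrite big1 // => c _; rewrite big1 // => a _.
by have [->|->] := ord2_cases c; rewrite ?di ?dj !(mulr0, mul0r) subrr.
Qed.

Lemma projQ_coord (z : quad C k) v : qrep_coord (projQ z) v = quad_coord z (varQ v).
Proof. by case: v => [[[a b]|a]|a] /=; rewrite ?mxE. Qed.

Lemma projQop_coord (z : quad C k) v : qrep_coord (projQop z) v = quad_coord z (varQop v).
Proof. by case: v => [[[a b]|a]|a] /=; rewrite ?mxE. Qed.

Lemma projQ_act g (z : quad C k) : projQ (quad_act g z) = qrep_act g (projQ z).
Proof. by rewrite /projQ /qrep_act /= row_mul !colE mulmxA. Qed.

Lemma projQop_act g (z : quad C k) : projQop (quad_act g z) = qrep_act g (projQop z).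
Proof. by rewrite /projQop /qrep_act /= row_mul !colE mulmxA. Qed.

Theorem poisson_generators : (0 < k)%N ->
  [/\ commutative_poisson_subalgN (@invQ C k tau),
      commutative_poisson_subalgN (@invQop C k tau)
    & forall f : level -> C,
        poisson_generatedN (fun g : level -> C => invQ g \/ invQop g) f <-> regN f].
Proof.
move=> k_gt0; split.
- exact: quiver_functions_commutative projQ_coord projQ_act bracket_varQ.
- exact: quiver_functions_commutative projQop_coord projQop_act bracket_varQop.
move=> f; split=> [fG|fR S Sp SG].
  apply: (fG (@regN C k tau) regN_poisson_subalg) => g [gQ|gQ].
    exact: (@quiver_function_reg _ _ projQ_coord projQ_act g gQ).
  exact: (@quiver_function_reg _ _ projQop_coord projQop_act g gQ).
have SQ g : invQ g -> S g by move=> gQ; apply: SG; left.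
have SQop g : invQop g -> S g by move=> gQ; apply: SG; right.
apply: regN_subalgebra fR => //.
- by case: Sp => -[_ Sc Sa Sm] _; split.
- by move=> c d w; apply: S_jwi.
- by move=> w; apply: S_trw.
Qed.

End Regular.

Theorem theorem3 (R : realType) (k : nat) (tau : R[i]) (hk : (1 <= k)%N) :
  [/\ commutative_poisson_subalgN (@invQ (R[i] : comUnitRingType) k tau),
      commutative_poisson_subalgN (@invQop (R[i] : comUnitRingType) k tau)
    & forall f : level k tau -> R[i],
        poisson_generatedN
          (fun g : level k tau -> R[i] => invQ g \/ invQop g) f
        <-> regN f].
Proof. exact: (@poisson_generators R[i] k tau hk). Qed.
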